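(* Let $\mathcal{N}=(\mathcal{X}_1\times\mathcal{X}_2,\ \rho^{B_1B_2}_{x_1,x_2},\ \mathcal{H}^{B_1}\otimes\mathcal{H}^{B_2})$ be a classical-quantum interference channel. Define $$\mathcal{R}_{\mathrm{Sato}}(\mathcal{N})=\bigcup_{p_Q(q)p_1(x_1|q)p_2(x_2|q)}\left\{(R_1,R_2)\in\mathbb{R}_+^2:\ \begin{array}{l}R_1\le I(X_1;B_1|X_2Q)_\theta,\\ R_2\le I(X_2;B_2|X_1Q)_\theta,\\ R_1+R_2\le I(X_1X_2;B_1B_2|Q)_\theta\end{array}\right\},$$ with the union over finite sets $\mathcal{Q}$ and such distributions, and $\theta^{QX_1X_2B_1B_2}=\sum_{q,x_1,x_2}p_Q(q)p_1(x_1|q)p_2(x_2|q)|q\rangle\langle q|^Q\otimes|x_1\rangle\langle x_1|^{X_1}\otimes|x_2\rangle\langle x_2|^{X_2}\otimes\rho^{B_1B_2}_{x_1,x_2}$. Then the capacity region of $\mathcal{N}$ is contained in $\mathcal{R}_{\mathrm{Sato}}(\mathcal{N})$.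
   Context: Interference channel: finite $\mathcal{X}_1,\mathcal{X}_2$, density operators $\rho^{B_1B_2}_{x_1,x_2}$ on finite-dimensional $\mathcal{H}^{B_1}\otimes\mathcal{H}^{B_2}$, Receiver $j$ holds $B_j$, $n$ uses give tensor products. An $(n,R_1,R_2,\epsilon)$ code: codebooks $\{x_1^n(m_1)\}$, $\{x_2^n(m_2)\}$ with $2^{nR_1},2^{nR_2}$ messages, POVMs $\{\Lambda_{m_1}\}$ on $B_1^n$ and $\{\Gamma_{m_2}\}$ on $B_2^n$, with $\frac{1}{|\mathcal{M}_1||\mathcal{M}_2|}\sum\mathrm{Tr}[(I-\Lambda_{m_1}\otimes\Gamma_{m_2})\rho^{B_1^nB_2^n}_{x_1^n(m_1),x_2^n(m_2)}]\le\epsilon$. $(R_1,R_2)$ is achievable if $(n,R_1-\delta,R_2-\delta,\epsilon)$ codes exist for all $\epsilon,\delta>0$ and large $n$; the capacity region is the closure of the achievable pairs. Mutual informations are quantum (base 2). *)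

(* Defs.v *)
From mathcomp Require Import all_boot all_order all_algebra.
From mathcomp Require Import all_classical all_reals all_analysis.
From mathcomp Require Import complex.
Set Implicit Arguments.
Unset Strict Implicit.
Unset Printing Implicit Defensive.
Import Order.TTheory GRing.Theory Num.Theory.
Local Open Scope ring_scope.

(* Finite-dimensional quantum mechanics.  A finite-dimensional Hilbert    *)
(* space is C^T for a finite type T (the labels of an orthonormal basis); *)
(* a linear operator on it is its matrix (A s t)_{s,t : T}.               *)
(* Tensor products of spaces are products of the label types.           *)

Definition Op (R : realType) (T : finType) := T -> T -> R[i].

Section QM.
Variable R : realType.

Definition op_tr (T : finType) (A : Op R T) : R[i] := \sum_(t : T) A t t.

Definition op_mul (T : finType) (A B : Op R T) : Op R T :=
  fun s t => \sum_(u : T) A s u * B u t.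

Definition op_id (T : finType) : Op R T := fun s t => (s == t)%:R.

Definition op_sub (T : finType) (A B : Op R T) : Op R T := fun s t => A s t - B s t.

Definition op_tens (T U : finType) (A : Op R T) (B : Op R U) : Op R (T * U)%type :=
  fun s t => A s.1 t.1 * B s.2 t.2.

Definition hermitian (T : finType) (A : Op R T) : Prop :=
  forall s t, A t s = conjc (A s t).

Definition psd (T : finType) (A : Op R T) : Prop :=
  hermitian A /\
  forall v : T -> R[i], 0 <= \sum_(s : T) \sum_(t : T) conjc (v s) * A s t * v t.

Definition density (T : finType) (A : Op R T) : Prop := psd A /\ op_tr A = 1.

Definition povm (M T : finType) (L : M -> Op R T) : Prop :=
  (forall m, psd (L m)) /\ (forall s t, \sum_(m : M) L m s t = op_id s t).

(* Partial trace: the system with labels T is split bijectively as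
   (k, r) : T -> K * J; ptrace k r A is the partial trace of A over the
   J-part, an operator on C^K. *)
Definition ptrace (T K J : finType) (k : T -> K) (r : T -> J) (A : Op R T) : Op R K :=
  fun a b => \sum_(s : T | k s == a) \sum_(t : T | (k t == b) && (r s == r t)) A s t.

Definition op_mx (T : finType) (A : Op R T) : 'M[R[i]]_#|T| :=
  \matrix_(i, j) A (enum_val i) (enum_val j).

(* the eigenvalues (with multiplicity) = roots of the characteristic polynomial *)
Definition op_eigenvalues (T : finType) (A : Op R T) : seq R[i] :=
  sval (closed_field_poly_normal (char_poly (op_mx A))).

Definition log2 (x : R) : R := ln x / ln 2.

(* von Neumann entropy (base 2), -Tr rho log rho = - sum_l l log2 l,
   with the convention 0 log 0 = 0. *)
Definition vN_entropy (T : finType) (A : Op R T) : R :=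
  - \sum_(l <- op_eigenvalues A)
      (if complex.Re l == 0 then 0 else complex.Re l * log2 (complex.Re l)).

End QM.

Section ICchannel.
Variables (R : realType) (X1 X2 B1 B2 : finType).
Variable rho : X1 -> X2 -> Op R (B1 * B2)%type.

Definition rho_n (n : nat) (x1 : {ffun 'I_n -> X1}) (x2 : {ffun 'I_n -> X2})
  : Op R ({ffun 'I_n -> B1} * {ffun 'I_n -> B2})%type :=
  fun s t => \prod_(i < n) rho (x1 i) (x2 i) (s.1 i, s.2 i) (t.1 i, t.2 i).

(* M is the number of messages for rate Rt: M = ceil (2^(n Rt)) *)
Definition msg_count (n : nat) (Rt : R) (M : nat) : Prop :=
  2 `^ (n%:R * Rt) <= M%:R /\ M.-1%:R < 2 `^ (n%:R * Rt).

Definition code_exists (n : nat) (R1 R2 eps : R) : Prop :=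
  exists (M1 M2 : nat)
         (c1 : 'I_M1 -> {ffun 'I_n -> X1}) (c2 : 'I_M2 -> {ffun 'I_n -> X2})
         (L : 'I_M1 -> Op R {ffun 'I_n -> B1})
         (G : 'I_M2 -> Op R {ffun 'I_n -> B2}),
    [/\ msg_count n R1 M1, msg_count n R2 M2, povm L, povm G &
      (M1 * M2)%:R^-1 *
        (\sum_(m1 < M1) \sum_(m2 < M2)
           op_tr (op_mul (op_sub (@op_id R _) (op_tens (L m1) (G m2)))
                         (rho_n (c1 m1) (c2 m2))))
      <= real_complex R eps].

Definition achievable (R1 R2 : R) : Prop :=
  0 <= R1 /\ 0 <= R2 /\
  forall eps delta : R, 0 < eps -> 0 < delta ->
    exists N : nat, forall n : nat, (N <= n)%N -> code_exists n (R1 - delta) (R2 - delta) eps.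

Definition in_capacity_region (R1 R2 : R) : Prop :=
  forall e : R, 0 < e -> exists a b : R, achievable a b /\ `|a - R1| < e /\ `|b - R2| < e.

Definition theta (Q : finType) (pQ : Q -> R) (p1 : Q -> X1 -> R) (p2 : Q -> X2 -> R)
  : Op R (Q * X1 * X2 * B1 * B2)%type :=
  fun s t =>
    let: ((((q, x1), x2), b1), b2) := s in
    let: ((((q', x1'), x2'), b1'), b2') := t in
    ((q == q') && (x1 == x1') && (x2 == x2'))%:R *
    real_complex R (pQ q * p1 q x1 * p2 q x2) * rho x1 x2 (b1, b2) (b1', b2').

Definition is_distr (T : finType) (p : T -> R) : Prop :=
  (forall t, 0 <= p t) /\ \sum_(t : T) p t = 1.

End ICchannel.

Section Proj.
Variables (Q X1 X2 B1 B2 : finType).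
Local Notation T := (Q * X1 * X2 * B1 * B2)%type.
Definition lQ (t : T) : Q := t.1.1.1.1.
Definition lX1 (t : T) : X1 := t.1.1.1.2.
Definition lX2 (t : T) : X2 := t.1.1.2.
Definition lB1 (t : T) : B1 := t.1.2.
Definition lB2 (t : T) : B2 := t.2.
End Proj.

Definition Hred (R : realType) (T K J : finType) (A : Op R T) (k : T -> K) (r : T -> J) : R :=
  vN_entropy (ptrace k r A).

Section MI.
Variables (R : realType) (Q X1 X2 B1 B2 : finType).
Variable th : Op R (Q * X1 * X2 * B1 * B2)%type.
Local Notation H := (Hred th).

Definition I_X1_B1_given_X2Q : R :=
  H (fun t => (lX1 t, lX2 t, lQ t)) (fun t => (lB1 t, lB2 t))
  + H (fun t => (lB1 t, lX2 t, lQ t)) (fun t => (lX1 t, lB2 t))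
  - H (fun t => (lX1 t, lB1 t, lX2 t, lQ t)) (fun t => lB2 t)
  - H (fun t => (lX2 t, lQ t)) (fun t => (lX1 t, lB1 t, lB2 t)).

Definition I_X2_B2_given_X1Q : R :=
  H (fun t => (lX2 t, lX1 t, lQ t)) (fun t => (lB1 t, lB2 t))
  + H (fun t => (lB2 t, lX1 t, lQ t)) (fun t => (lX2 t, lB1 t))
  - H (fun t => (lX2 t, lB2 t, lX1 t, lQ t)) (fun t => lB1 t)
  - H (fun t => (lX1 t, lQ t)) (fun t => (lX2 t, lB1 t, lB2 t)).

Definition I_X1X2_B1B2_given_Q : R :=
  H (fun t => (lX1 t, lX2 t, lQ t)) (fun t => (lB1 t, lB2 t))
  + H (fun t => (lB1 t, lB2 t, lQ t)) (fun t => (lX1 t, lX2 t))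
  - H (fun t => (lX1 t, lX2 t, lB1 t, lB2 t, lQ t)) (fun _ => tt)
  - H (fun t => lQ t) (fun t => (lX1 t, lX2 t, lB1 t, lB2 t)).
End MI.

Definition in_R_Sato (R : realType) (X1 X2 B1 B2 : finType)
  (rho : X1 -> X2 -> Op R (B1 * B2)%type) (R1 R2 : R) : Prop :=
  exists (Q : finType) (pQ : Q -> R) (p1 : Q -> X1 -> R) (p2 : Q -> X2 -> R),
    [/\ is_distr pQ, (forall q, is_distr (p1 q)), (forall q, is_distr (p2 q)),
        0 <= R1 /\ 0 <= R2 &
        let th := theta rho pQ p1 p2 in
        [/\ R1 <= I_X1_B1_given_X2Q th,
            R2 <= I_X2_B2_given_X1Q th &
            R1 + R2 <= I_X1X2_B1B2_given_Q th]].

(* Main.v *)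
Require Import Defs.
From mathcomp Require Import all_boot all_order all_algebra.
From mathcomp Require Import all_classical all_reals all_analysis.
From mathcomp Require Import complex ring lra.
Import Order.TTheory GRing.Theory Num.Theory.
Local Open Scope ring_scope.

(* Converse.  Message [m] of a code is tested against the product state
   [sigma = \otimes_k omega_k] of the letterwise averages of the output states.
   If [rho] and [sigma] have spectra [(r_i, u_i)] and [(s_j, v_j)], then for every
   test [L] (Nussbaum-Szkola)
     Tr (1 - L) rho + lam Tr L sigma >= 1/2 sum_ij min (r_i, lam s_j) |<u_i, v_j>|^2,
   which bounds from below the relative entropy
     D (rho || sigma) = sum_ij r_i |<u_i, v_j>|^2 (ln r_i - ln s_j).
   As [sigma] is a product, [D] is a sum over the letters, and its average over the
   messages is the sum of the single-letter Holevo quantities.  Compared with Fano's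
   inequality and the Holevo bound only a factor 2 in front of the error probability
   is lost, and no monotonicity of the quantum relative entropy is needed.

   Passage to the limit.  Each code gives a time-sharing distribution on its [n]
   positions; Caratheodory's theorem in dimension 4 cuts it down to 4 values, so that
   all parameters live in one compact set.  The entropy is an infimum of functions
   linear in the state (Klein's inequality), hence the informations are upper
   semicontinuous in the input distributions and the bounds survive the limit. *)

Set Implicit Arguments.
Unset Strict Implicit.
Unset Printing Implicit Defensive.

(** * Real parts and squared moduli of complex numbers *)

Section ComplexNumbers.
Variable R : realType.
Local Notation C := (R[i]).
Local Open Scope complex_scope.

(** The squared modulus as an element of [R], so that overlaps can serve as real weights. *)
Definition nsq (z : C) : R := complex.Re z ^+ 2 + complex.Im z ^+ 2.

Lemma nsq_ge0 z : 0 <= nsq z.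
Proof. by rewrite addr_ge0 ?sqr_ge0. Qed.

Lemma mulJ_nsq (z : C) : conjc z * z = (nsq z)%:C.
Proof.
case: z => a b; apply/eqP; rewrite eq_complex /nsq /=; apply/andP; split; apply/eqP; ring.
Qed.

Lemma conjcM (x y : C) : conjc (x * y) = conjc x * conjc y.
Proof. exact: rmorphM. Qed.

Lemma nsqJ (z : C) : nsq (conjc z) = nsq z.
Proof. by case: z => a b; rewrite /nsq /= sqrrN. Qed.

(** Parallelogram identity with one square dropped; this is the source of the factor 2 in
    [nussbaum_szkola]. *)
Lemma nsqD_le (a b : C) : nsq (a + b) <= 2 * (nsq a + nsq b).
Proof. by case: a b => [a a'] [b b']; rewrite /nsq /=; have := sqr_ge0 (a - b); have := sqr_ge0 (a' - b'); lra. Qed.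

Lemma ReD (x y : C) : complex.Re (x + y) = complex.Re x + complex.Re y.
Proof. by case: x y => [a b] [c d]. Qed.

Lemma ReB (x y : C) : complex.Re (x - y) = complex.Re x - complex.Re y.
Proof. by case: x y => [a b] [c d]. Qed.

Lemma Re_sum (I : Type) (r : seq I) (P : pred I) (F : I -> C) :
  complex.Re (\sum_(i <- r | P i) F i) = \sum_(i <- r | P i) complex.Re (F i).
Proof. exact: (big_morph (@complex.Re R) ReD). Qed.

Lemma Re_realM (a : R) (z : C) : complex.Re (a%:C * z) = a * complex.Re z.
Proof. by case: z => b c /=; ring. Qed.

Lemma Re_ge0 (z : C) : 0 <= z -> 0 <= complex.Re z.
Proof. by rewrite lecE => /andP[]. Qed.

Lemma ge0_ReK (z : C) : 0 <= z -> (complex.Re z)%:C = z.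
Proof. by case: z => a b; rewrite lecE /= => /andP[/eqP ->]. Qed.

Lemma Re_le (x y : C) : x <= y -> complex.Re x <= complex.Re y.
Proof. by rewrite lecE => /andP[]. Qed.

End ComplexNumbers.

(** * Orthonormal bases and the spectral theorem *)

Section Eigendecomposition.
Variable R : realType.
Local Notation C := (R[i]).
Local Open Scope complex_scope.

Definition dot (T : finType) (x y : T -> C) : C := \sum_s conjc (x s) * y s.

Definition app (T : finType) (A : Op R T) (v : T -> C) : T -> C :=
  fun s => \sum_t A s t * v t.

Definition expect (T : finType) (A : Op R T) (v : T -> C) : R :=
  complex.Re (dot v (app A v)).

(** Orthonormality and completeness are both required: [J] and [T] are unrelated types, and neither
    property implies the other before their cardinalities are known to agree. *)
Definition onb (T J : finType) (u : J -> T -> C) : Prop :=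
  (forall j k, dot (u j) (u k) = (j == k)%:R) /\
  (forall s t, \sum_j u j s * conjc (u j t) = (s == t)%:R).

(* The eigenvalues may be indexed by any finite type: eigenbases of tensor
   products and of block-diagonal operators then need no reindexing. *)
Definition eigendec (T J : finType) (A : Op R T) (l : J -> R) (u : J -> T -> C) : Prop :=
  onb u /\ forall s t, A s t = \sum_j (l j)%:C * (u j s * conjc (u j t)).

Lemma dotJ (T : finType) (x y : T -> C) : conjc (dot x y) = dot y x.
Proof.
rewrite /dot raddf_sum; apply: eq_bigr => s _ /=.
by rewrite rmorphM /= conjcK mulrC.
Qed.

Lemma dotBr (T : finType) (x y z : T -> C) :
  dot x (fun s => y s - z s) = dot x y - dot x z.
Proof. by rewrite -sumrB; apply: eq_bigr => s _; rewrite mulrBr. Qed.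

Lemma dotBl (T : finType) (x y z : T -> C) :
  dot (fun s => y s - z s) x = dot y x - dot z x.
Proof. by rewrite -dotJ dotBr rmorphB /= !dotJ. Qed.

Lemma dot_app (T : finType) (A : Op R T) x y :
  dot x (app A y) = \sum_s \sum_t conjc (x s) * A s t * y t.
Proof.
by apply: eq_bigr => s _; rewrite mulr_sumr; apply: eq_bigr => t _; rewrite mulrA.
Qed.

Lemma hermitian_dot (T : finType) (A : Op R T) x y :
  Defs.hermitian A -> dot x (app A y) = dot (app A x) y.
Proof.
move=> hA; rewrite -[RHS]dotJ !dot_app raddf_sum exchange_big; apply: eq_bigr => s _ /=.
rewrite raddf_sum; apply: eq_bigr => t _ /=.
rewrite !rmorphM /= conjcK -hA; ring.
Qed.

(** Parseval: the resolution of the identity given by [v] is inserted between [x] and [y]. *)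
Lemma dot_onb (T J : finType) (v : J -> T -> C) (x y : T -> C) :
  onb v -> dot x y = \sum_j dot x (v j) * dot (v j) y.
Proof.
move=> [_ hc]; transitivity (\sum_s \sum_t conjc (x s) * y t * (s == t)%:R).
  apply: eq_bigr => s _; rewrite (bigD1 s) //= eqxx mulr1 big1 ?addr0 // => t.
  by rewrite eq_sym => /negbTE ->; rewrite mulr0.
transitivity (\sum_s \sum_t \sum_j conjc (x s) * y t * (v j s * conjc (v j t))).
  by apply: eq_bigr => s _; apply: eq_bigr => t _; rewrite -hc mulr_sumr.
under eq_bigr do rewrite exchange_big.
rewrite exchange_big; apply: eq_bigr => j _ /=.
rewrite /dot mulr_suml; apply: eq_bigr => s _; rewrite mulr_sumr; apply: eq_bigr => t _.
by ring.
Qed.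

Lemma onb_norm (T J : finType) (v : J -> T -> C) (x : T -> C) :
  onb v -> dot x x = (\sum_j nsq (dot (v j) x))%:C.
Proof.
move=> hv; rewrite (dot_onb x x hv) rmorph_sum; apply: eq_bigr => j _ /=.
by rewrite -dotJ mulJ_nsq.
Qed.

Lemma onb_norm1 (T J : finType) (v : J -> T -> C) (x : T -> C) :
  onb v -> dot x x = 1 -> \sum_j nsq (dot (v j) x) = 1.
Proof. by move=> hv h; apply: complexI; rewrite -onb_norm. Qed.

(** Double counting of the sum of [|u j s|^2] over [j] and [s]: orthonormality gives [#|J|],
    completeness gives [#|T|]. *)
Lemma onb_card (T J : finType) (u : J -> T -> C) : onb u -> #|J| = #|T|.
Proof.
move=> [h1 h2]; apply/eqP; rewrite -(eqr_nat C).
rewrite -![in X in _ == X]sumr_const -sumr_const.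
have E (I : finType) : \sum_(i in I) (1 : C) = \sum_(i : I) (i == i)%:R.
  by apply: eq_bigr => i _; rewrite eqxx.
rewrite !E; under eq_bigr do rewrite -h1.
under [X in _ == X]eq_bigr do rewrite -h2.
rewrite exchange_big /=; apply/eqP; apply: eq_bigr => s _; apply: eq_bigr => j _.
by rewrite mulrC.
Qed.

Lemma hermitian_eigendec (T : finType) (A : Op R T) : Defs.hermitian A ->
  exists (l : T -> R) (u : T -> T -> C), eigendec A l u.
Proof.
move=> hA; set M := op_mx A.
have hM : M \is hermsymmx.
  apply/is_hermitianmxP; rewrite expr0 scale1r; apply/matrixP => i j.
  by rewrite !mxE hA; congr (_ _).
have /orthomx_spectralP E := hermitian_normalmx hM.
have real := hermitian_spectral_diag_real hM.
have U := spectral_unitarymx M.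
set P := spectralmx M in E U; set d := spectral_diag M in E real.
have PP : P *m (P ^t Num.Def.conjC)%sesqui = 1%:M by apply/unitarymxP.
have PP' : (P ^t Num.Def.conjC)%sesqui *m P = 1%:M by apply/mulmx1C.
(* From [M = P^* D P] the eigenvectors are the conjugated rows of [P]; the eigenvalues are real, so
   [Re] loses nothing. *)
exists (fun t => complex.Re (d 0 (enum_rank t))), (fun j s => conjc (P (enum_rank j) (enum_rank s))).
split; first split.
- move=> j k; move/matrixP: PP => /(_ (enum_rank j) (enum_rank k)).
  rewrite !mxE (inj_eq enum_rank_inj) => <-.
  rewrite /dot (reindex_onto enum_val enum_rank) /=; last by move=> i _; rewrite enum_rankK.
  apply: eq_big => [i|i _]; first by rewrite enum_valK eqxx.
  by rewrite enum_valK conjcK !mxE.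
- move=> s t; move/matrixP: PP' => /(_ (enum_rank s) (enum_rank t)).
  rewrite !mxE (inj_eq enum_rank_inj) => <-.
  rewrite (reindex_onto enum_val enum_rank) /=; last by move=> i _; rewrite enum_rankK.
  apply: eq_big => [i|i _]; first by rewrite enum_valK eqxx.
  by rewrite enum_valK conjcK !mxE.
- move=> s t; move/matrixP: E => /(_ (enum_rank s) (enum_rank t)).
  rewrite [M _ _]mxE !enum_rankK => ->.
  rewrite invmx_unitary // mul_mx_diag mxE.
  rewrite [RHS](reindex_onto enum_val enum_rank) /=; last by move=> i _; rewrite enum_rankK.
  apply: eq_big => [i|i _]; first by rewrite enum_valK eqxx.
  rewrite enum_valK conjcK !mxE RRe_real; last first.
    by move/mxOverP: real; apply.
  by rewrite mulrAC mulrC mulrA.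
Qed.

End Eigendecomposition.

(** * An inequality for the natural logarithm *)

Section Logarithm.
Variable R : realType.

Lemma ln2_gt0 : 0 < ln 2 :> R.
Proof. by rewrite ln_gt0 // ltr1n. Qed.

(** This is [ln x <= x - 1] at [x = q / p]. The condition on zeros is absolute continuity: at
    [q = 0] the logarithm is only a default value. *)
Lemma xlnx_ge (p q : R) : 0 <= p -> 0 <= q -> (q = 0 -> p = 0) ->
  p - q <= p * (ln p - ln q).
Proof.
move=> p0 q0 pq.
have [->|p_neq0] := eqVneq p 0; first by rewrite mul0r sub0r oppr_le0.
have pp : 0 < p by rewrite lt_neqAle eq_sym p_neq0.
have qp : 0 < q.
  by rewrite lt_neqAle q0 andbT eq_sym; apply: contra_neq p_neq0.
have : ln (q / p) <= q / p - 1.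
  have := @le_ln1Dx R (q / p - 1); rewrite [1 + _]addrC subrK; apply.
  by rewrite ltrBDl addrN divr_gt0.
rewrite ln_div ?posrE // => h.
rewrite -subr_ge0.
have -> : p * (ln p - ln q) - (p - q) = p * ((q / p - 1) - (ln q - ln p)).
  by field.
by rewrite mulr_ge0 // subr_ge0.
Qed.

End Logarithm.

(** * Von Neumann entropy, Klein's inequality and mixtures of states *)

Section Entropy.
Variable R : realType.
Local Notation C := (R[i]).
Local Open Scope complex_scope.

(** Entropy in nats. Zero weights need no separate case, since [0 * ln 0] is 0 whatever [ln 0]
    is. *)
Definition nent (J : finType) (l : J -> R) : R := - \sum_j l j * ln (l j).

(** The eigenvectors are the columns of a matrix [V] with inverse [W], so [op_mx A] is similar to a
    diagonal matrix. The bijections [e] and [e'] number [J] by matrix indices, as [onb_card]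
    permits. *)
Lemma char_poly_eigendec (T J : finType) (A : Op R T) (l : J -> R) u :
  eigendec A l u -> char_poly (op_mx A) = \prod_(j : J) ('X - ((l j)%:C)%:P).
Proof.
move=> [[h1 h2] h3]; have hc := onb_card (conj h1 h2).
pose e (i : 'I_#|T|) : J := enum_val (cast_ord (esym hc) i).
pose e' (j : J) : 'I_#|T| := cast_ord hc (enum_rank j).
have ee' : cancel e' e by move=> j; rewrite /e /e' cast_ordK enum_rankK.
have e'e : cancel e e' by move=> i; rewrite /e /e' enum_valK cast_ordKV.
pose V : 'M[C]_#|T| := \matrix_(i, j) u (e j) (enum_val i).
pose W : 'M[C]_#|T| := \matrix_(i, j) conjc (u (e i) (enum_val j)).
pose d : 'rV[C]_#|T| := \row_j (l (e j))%:C.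
have WV : W *m V = 1%:M.
  apply/matrixP => i j; rewrite !mxE -(can_eq e'e) -h1.
  rewrite /dot [RHS](reindex_onto enum_val enum_rank) /=; last by move=> k _; rewrite enum_rankK.
  apply: eq_big => [k|k _]; first by rewrite enum_valK eqxx.
  by rewrite !mxE.
have E : op_mx A = V *m diag_mx d *m W.
  apply/matrixP => i j; rewrite mul_mx_diag !mxE h3.
  rewrite [LHS](reindex_onto e e') /=; last by move=> k _; rewrite ee'.
  apply: eq_big => [k|k _]; first by rewrite e'e eqxx.
  by rewrite !mxE mulrA; congr (_ * _); rewrite mulrC.
have VW := mulmx1C WV.
transitivity (char_poly (diag_mx d)).
  rewrite /char_poly E.
  have -> : char_poly_mx (V *m diag_mx d *m W) =
      map_mx polyC V *m char_poly_mx (diag_mx d) *m map_mx polyC W.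
    rewrite /char_poly_mx mulmxBr mulmxBl -!map_mxM; congr (_ - _).
    by rewrite -mulmxA mul_scalar_mx -scalemxAr -map_mxM VW map_mx1 scalemx1.
  rewrite !det_mulmx mulrAC -det_mulmx -map_mxM VW map_mx1 det1 mul1r //.
rewrite char_poly_trig; last by apply/is_trig_mxP => i j ij; rewrite !mxE -val_eqE /= ltn_eqF.
rewrite [RHS](reindex_onto e e') /=; last by move=> k _; rewrite ee'.
apply: eq_big => [k|k _]; first by rewrite e'e eqxx.
by rewrite !mxE eqxx mulr1n.
Qed.

(** The list [op_eigenvalues] comes from an arbitrary factorization, but a split monic polynomial
    determines its roots up to order; hence any eigendecomposition computes the entropy. *)
Lemma vN_entropy_eigendec (T J : finType) (A : Op R T) (l : J -> R) u :
  eigendec A l u -> vN_entropy A = nent l / ln 2.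
Proof.
move=> h; rewrite /vN_entropy /op_eigenvalues.
case: (closed_field_poly_normal _) => r /= hr.
have : perm_eq r [seq (l j)%:C | j <- index_enum J].
  apply: prod_XsubC_eq; rewrite big_map -(char_poly_eigendec h) hr.
  by rewrite (monicP (char_poly_monic _)) scale1r.
move=> hp; rewrite (perm_big _ hp) /= big_map /nent mulNr mulr_suml; congr (- _).
apply: eq_bigr => j _ /=; case: eqP => [->|_]; first by rewrite !mul0r.
by rewrite /log2 mulrA.
Qed.

Lemma vN_entropyE (T J : finType) (A : Op R T) (l : J -> R) u :
  eigendec A l u -> ln 2 * vN_entropy A = nent l.
Proof. by move=> /vN_entropy_eigendec ->; rewrite mulrC divfK // gt_eqF // ln2_gt0. Qed.

Lemma eigendec_app (T J : finType) (A : Op R T) (l : J -> R) u x y :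
  eigendec A l u -> dot x (app A y) = \sum_j (l j)%:C * (dot x (u j) * dot (u j) y).
Proof.
move=> [_ h]; rewrite dot_app.
transitivity (\sum_s \sum_t \sum_j conjc (x s) * ((l j)%:C * (u j s * conjc (u j t))) * y t).
  by apply: eq_bigr => s _; apply: eq_bigr => t _; rewrite h mulr_sumr mulr_suml.
under eq_bigr do rewrite exchange_big.
rewrite exchange_big; apply: eq_bigr => j _ /=.
rewrite /dot mulr_suml mulr_sumr; apply: eq_bigr => s _.
rewrite !mulr_sumr; apply: eq_bigr => t _; ring.
Qed.

Lemma eigendec_expectC (T J : finType) (A : Op R T) (l : J -> R) u x :
  eigendec A l u -> dot x (app A x) = (\sum_j l j * nsq (dot (u j) x))%:C.
Proof.
move=> h; rewrite (eigendec_app _ _ h) rmorph_sum; apply: eq_bigr => j _ /=.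
by rewrite rmorphM /= -mulJ_nsq dotJ.
Qed.

Lemma eigendec_expect (T J : finType) (A : Op R T) (l : J -> R) u x :
  eigendec A l u -> expect A x = \sum_j l j * nsq (dot (u j) x).
Proof. by move=> h; rewrite /expect (eigendec_expectC _ h). Qed.

Lemma eigendec_expect_eigenvector (T J : finType) (A : Op R T) (l : J -> R) u j :
  eigendec A l u -> expect A (u j) = l j.
Proof.
move=> h; rewrite (eigendec_expect _ h) (bigD1 j) //= big1 => [|k kj].
  by rewrite h.1.1 eqxx /nsq /= expr1n expr0n /= !addr0 mulr1.
by rewrite h.1.1 (negbTE kj) /nsq /= expr0n /= !addr0 mulr0.
Qed.

Lemma psd_expect_ge0 (T : finType) (A : Op R T) x : psd A -> 0 <= expect A x.
Proof. by move=> [_ h]; apply: Re_ge0; rewrite dot_app. Qed.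

Lemma psd_expectC (T : finType) (A : Op R T) x : psd A -> dot x (app A x) = (expect A x)%:C.
Proof. by move=> [_ h]; rewrite /expect ge0_ReK // dot_app. Qed.

Lemma eigendec_ge0 (T J : finType) (A : Op R T) (l : J -> R) u :
  psd A -> eigendec A l u -> forall j, 0 <= l j.
Proof. by move=> hA h j; rewrite -(eigendec_expect_eigenvector j h) psd_expect_ge0. Qed.

Lemma eigendec_hermitian (T J : finType) (A : Op R T) (l : J -> R) u :
  eigendec A l u -> Defs.hermitian A.
Proof.
move=> [_ h] s t; rewrite !h raddf_sum; apply: eq_bigr => j _ /=.
by rewrite !conjcM conjcK conjc_real; congr (_ * _); rewrite mulrC.
Qed.

Lemma eigendec_psd (T J : finType) (A : Op R T) (l : J -> R) u :
  eigendec A l u -> (forall j, 0 <= l j) -> psd A.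
Proof.
move=> h l0; split; first exact: eigendec_hermitian h.
move=> v; rewrite -dot_app (eigendec_expectC _ h) ler0c.
by apply: sumr_ge0 => j _; rewrite mulr_ge0 ?nsq_ge0.
Qed.

Lemma tr_mul_eigendec (T J : finType) (L A : Op R T) (l : J -> R) u :
  eigendec A l u -> op_tr (op_mul L A) = \sum_j (l j)%:C * dot (u j) (app L (u j)).
Proof.
move=> [_ h]; rewrite /op_tr /op_mul.
transitivity (\sum_s \sum_t \sum_j L s t * ((l j)%:C * (u j t * conjc (u j s)))).
  by apply: eq_bigr => s _; apply: eq_bigr => t _; rewrite h mulr_sumr.
under eq_bigr do rewrite exchange_big.
rewrite exchange_big; apply: eq_bigr => j _ /=.
rewrite dot_app mulr_sumr; apply: eq_bigr => s _.
rewrite !mulr_sumr; apply: eq_bigr => t _; ring.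
Qed.

Lemma tr_eigendec (T J : finType) (A : Op R T) (l : J -> R) u :
  eigendec A l u -> op_tr A = (\sum_j l j)%:C.
Proof.
move=> [[h1 _] h]; rewrite /op_tr.
under eq_bigr do rewrite h.
rewrite exchange_big rmorph_sum; apply: eq_bigr => j _ /=.
rewrite -mulr_sumr -[RHS]mulr1; congr (_ * _).
rewrite -[RHS](_ : (j == j)%:R = 1 :> C); last by rewrite eqxx.
by rewrite -h1; apply: eq_bigr => s _; rewrite mulrC.
Qed.

Lemma density_eigendec (T : finType) (A : Op R T) : density A ->
  exists (l : T -> R) (u : T -> T -> C),
    [/\ eigendec A l u, forall j, 0 <= l j & \sum_j l j = 1].
Proof.
move=> [hA tA]; have [l [u h]] := hermitian_eigendec hA.1.
exists l, u; split => //; first exact: eigendec_ge0 h.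
by apply: complexI; rewrite -(tr_eigendec h) tA.
Qed.

(** Together with the next lemma: the squared overlaps of two orthonormal bases form a doubly
    stochastic array. *)
Lemma onb_overlap_suml (T J K : finType) (u : J -> T -> C) (v : K -> T -> C) k :
  onb u -> onb v -> \sum_j nsq (dot (u j) (v k)) = 1.
Proof. by move=> hu hv; apply: onb_norm1 => //; rewrite hv.1 eqxx. Qed.

Lemma onb_overlap_sumr (T J K : finType) (u : J -> T -> C) (v : K -> T -> C) j :
  onb u -> onb v -> \sum_k nsq (dot (u j) (v k)) = 1.
Proof.
move=> hu hv; rewrite -[RHS](onb_overlap_suml j hv hu).
by apply: eq_bigr => k _; rewrite -dotJ nsqJ.
Qed.

(** Klein's inequality. Both sides are expanded with the overlaps as weights, and [xlnx_ge] is
    applied to each pair [(l j, s k)]; double stochasticity turns the remainder into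
    [1 - \sum_k s k], which is nonnegative. *)
Lemma entropy_le_cross (T J K : finType) (A : Op R T) (l : J -> R) u (s : K -> R) v :
  psd A -> \sum_j l j = 1 -> eigendec A l u -> onb v ->
  (forall k, 0 < s k) -> \sum_k s k <= 1 ->
  nent l <= - \sum_k expect A (v k) * ln (s k).
Proof.
move=> hA l1 hu hv s0 s1; have l0 := eigendec_ge0 hA hu; rewrite lerN2.
rewrite -subr_ge0; apply: le_trans (_ : \sum_j \sum_k nsq (dot (u j) (v k)) * (l j - s k) <= _).
  have -> : \sum_j \sum_k nsq (dot (u j) (v k)) * (l j - s k) = \sum_j l j - \sum_k s k.
    under eq_bigr do under eq_bigr do rewrite mulrBr.
    under eq_bigr do rewrite sumrB.
    rewrite sumrB; congr (_ - _).
      by apply: eq_bigr => j _; rewrite -mulr_suml onb_overlap_sumr ?mul1r //; exact: hu.1.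
    rewrite exchange_big; apply: eq_bigr => k _ /=.
    by rewrite -mulr_suml onb_overlap_suml ?mul1r //; exact: hu.1.
  by rewrite l1 subr_ge0.
have -> : \sum_j l j * ln (l j) - \sum_k expect A (v k) * ln (s k) =
   \sum_j \sum_k nsq (dot (u j) (v k)) * (l j * (ln (l j) - ln (s k))).
  under [RHS]eq_bigr do under eq_bigr do rewrite !mulrBr.
  under [RHS]eq_bigr do rewrite sumrB.
  rewrite sumrB; congr (_ - _).
    by apply: eq_bigr => j _; rewrite -mulr_suml onb_overlap_sumr ?mul1r //; exact: hu.1.
  rewrite exchange_big; apply: eq_bigr => k _ /=.
  by rewrite (eigendec_expect _ hu) mulr_suml; apply: eq_bigr => j _; ring.
apply: ler_sum => j _; apply: ler_sum => k _; rewrite ler_wpM2l ?nsq_ge0 //.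
by apply: xlnx_ge => //; [apply: ltW | move=> h; have := s0 k; rewrite h ltxx].
Qed.

Definition mix (X T : finType) (p : X -> R) (rho : X -> Op R T) : Op R T :=
  fun s t => \sum_x (p x)%:C * rho x s t.

Lemma mix_dot (X T : finType) (p : X -> R) (rho : X -> Op R T) v w :
  dot v (app (mix p rho) w) = \sum_x (p x)%:C * dot v (app (rho x) w).
Proof.
rewrite dot_app.
transitivity (\sum_s \sum_t \sum_x (p x)%:C * (conjc (v s) * rho x s t * w t)).
  apply: eq_bigr => s _; apply: eq_bigr => t _.
  by rewrite mulr_sumr mulr_suml; apply: eq_bigr => x _; ring.
under eq_bigr do rewrite exchange_big.
rewrite exchange_big; apply: eq_bigr => x _ /=; rewrite dot_app mulr_sumr.
by apply: eq_bigr => s _; rewrite mulr_sumr.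
Qed.

Lemma mix_expect (X T : finType) (p : X -> R) (rho : X -> Op R T) v :
  expect (mix p rho) v = \sum_x p x * expect (rho x) v.
Proof.
by rewrite /expect mix_dot Re_sum; apply: eq_bigr => x _; rewrite Re_realM.
Qed.

Lemma mix_density (X T : finType) (p : X -> R) (rho : X -> Op R T) :
  is_distr p -> (forall x, density (rho x)) -> density (mix p rho).
Proof.
move=> [p0 p1] h; split; first split.
- move=> s t; rewrite /mix raddf_sum; apply: eq_bigr => x _ /=.
  by rewrite conjcM conjc_real (h x).1.1.
- move=> v; rewrite -dot_app mix_dot; apply: sumr_ge0 => x _.
  by rewrite mulr_ge0 ?ler0c ?dot_app //; exact: (h x).1.2.
- rewrite /op_tr /mix exchange_big /=.
  transitivity (\sum_x (p x)%:C : C); last by rewrite -rmorph_sum p1.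
  by apply: eq_bigr => x _; rewrite -mulr_sumr [X in _ * X](h x).2 mulr1.
Qed.

(** Entropy is an infimum of functions linear in [p]: the cross entropy against a fixed reference
    state dominates it everywhere, and is nearly tight at [p] when the reference is a slight
    smoothing of the mixture at [p]. This gives upper semicontinuity later. *)
Lemma entropy_mix_majorant (X T : finType) (p : X -> R) (rho : X -> Op R T) (e : R) :
  (forall x, density (rho x)) -> is_distr p -> 0 < e ->
  exists c : X -> R,
    (forall p', is_distr p' -> ln 2 * vN_entropy (mix p' rho) <= \sum_x p' x * c x) /\
    \sum_x p x * c x <= ln 2 * vN_entropy (mix p rho) + e.
Proof.
move=> hrho hp e0.
have [l [u [hl l0 l1]]] := density_eigendec (mix_density hp hrho).
(* Adding [delta] to each eigenvalue keeps the reference spectrum [s] positive. The loss at [p] is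
   at most [ln (1 + d * delta) <= d * delta <= e]. *)
pose d : R := #|T|%:R; pose delta := e / (d + 1).
have d0 : 0 <= d by exact: ler0n.
have d1 : 0 < d + 1 by rewrite ltr_wpDl.
have delta0 : 0 < delta by rewrite divr_gt0.
have Z0 : 0 < 1 + d * delta by rewrite ltr_pwDl // mulr_ge0 // ltW.
have ld j : 0 < l j + delta by rewrite ltr_wpDl.
pose s j := (l j + delta) / (1 + d * delta).
have s0 j : 0 < s j by rewrite divr_gt0.
exists (fun x => - \sum_j expect (rho x) (u j) * ln (s j)).
have Ec p' : \sum_x p' x * - (\sum_j expect (rho x) (u j) * ln (s j)) =
    - \sum_j expect (mix p' rho) (u j) * ln (s j).
  under eq_bigr do rewrite mulrN mulr_sumr.
  rewrite sumrN exchange_big; congr (- _); apply: eq_bigr => j _ /=.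
  by rewrite mix_expect mulr_suml; apply: eq_bigr => x _; rewrite mulrA.
split=> [p' hp'|].
- rewrite Ec; have hm := mix_density hp' hrho.
  have [l' [u' [hl' l0' l1']]] := density_eigendec hm.
  rewrite (vN_entropyE hl'); apply: entropy_le_cross hl' _ _ _ => //.
  + exact: hm.1.
  + exact: hl.1.
  + by rewrite -mulr_suml big_split /= l1 sumr_const -mulr_natl -/d divff // gt_eqF.
- rewrite Ec (vN_entropyE hl) /nent -lerBlDl opprK.
  rewrite addrC -sumrB.
  apply: le_trans (_ : \sum_j l j * ln (1 + d * delta) <= _).
    apply: ler_sum => j _.
    rewrite (eigendec_expect_eigenvector j hl) /s ln_div ?posrE //.
    have [->|lj0] := eqVneq (l j) 0; first by rewrite !mul0r subrr.
    rewrite -mulrBr; apply: ler_wpM2l => //.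
    suff : ln (l j) <= ln (l j + delta) by lra.
    by rewrite ler_ln ?posrE // ?lerDl ?ltW // lt_neqAle eq_sym lj0 l0.
  rewrite -mulr_suml l1 mul1r (le_trans (le_ln1Dx _)) //; first by rewrite (lt_le_trans _ (mulr_ge0 d0 (ltW delta0))) // ltrN10.
  by rewrite /delta mulrCA ger_pMr // ler_pdivrMr // mul1r lerDl.
Qed.

End Entropy.

(** * Quantum hypothesis testing and relative entropy *)

Section HypothesisTesting.
Variable R : realType.
Local Notation C := (R[i]).
Local Open Scope complex_scope.

Lemma app_sub (T : finType) (A : Op R T) (v w : T -> C) :
  app A (fun s => v s - w s) = fun s => app A v s - app A w s.
Proof.
by apply/funext => s; rewrite /app -sumrB; apply: eq_bigr => t _; rewrite mulrBr.
Qed.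

Lemma app_op_idB (T : finType) (A : Op R T) (v : T -> C) :
  app (op_sub (@op_id R T) A) v = fun s => v s - app A v s.
Proof.
apply/funext => s; rewrite /app /op_sub /op_id.
under eq_bigr do rewrite mulrBl.
rewrite sumrB (bigD1 s) //= eqxx mul1r big1 ?addr0 // => t.
by rewrite eq_sym => /negbTE ->; rewrite mul0r.
Qed.

Lemma op_idBK (T : finType) (A : Op R T) : op_sub (@op_id R T) (op_sub (@op_id R T) A) = A.
Proof. by apply/funext => s; apply/funext => t; rewrite /op_sub subKr. Qed.

(* [L - L^2 = L (1 - L) L + (1 - L) L (1 - L)] *)
Lemma effect_square_le (T : finType) (L : Op R T) v :
  psd L -> psd (op_sub (@op_id R T) L) ->
  complex.Re (dot (app L v) (app L v)) <= expect L v.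
Proof.
move=> hL hL'; set x := app L v; pose y := fun s => v s - x s.
have := addr_ge0 (psd_expect_ge0 x hL') (psd_expect_ge0 y hL).
rewrite /expect -ReD app_op_idB /y app_sub dotBr !dotBr !dotBl -/x.
rewrite (hermitian_dot v x hL.1) -/x !(ReD, ReB).
by lra.
Qed.

(** With [B = 1 - L], each overlap of [u j] and [v k] splits into a [B] part and an [L] part, so it
    is at most [2 * (a j k + b j k)]. The minimum is bounded by [r j] on the first part and by
    [lam * s k] on the second, and [effect_square_le] turns the resulting squared norms into error
    probabilities. *)
Lemma nussbaum_szkola (T J K : finType) (rho sigma L : Op R T)
    (r : J -> R) (s : K -> R) u v (lam : R) :
  eigendec rho r u -> eigendec sigma s v ->
  (forall j, 0 <= r j) -> (forall k, 0 <= s k) -> 0 <= lam ->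
  psd L -> psd (op_sub (@op_id R T) L) ->
  \sum_j \sum_k nsq (dot (u j) (v k)) * Num.min (r j) (lam * s k) <=
  2 * (complex.Re (op_tr (op_mul (op_sub (@op_id R T) L) rho)) +
       lam * complex.Re (op_tr (op_mul L sigma))).
Proof.
move=> hr hs r0 s0 lam0 hL hL'; set B := op_sub _ L.
have hB : psd B by [].
have hB' : psd (op_sub (@op_id R T) B) by rewrite op_idBK.
pose a j k := nsq (dot (v k) (app B (u j))).
pose b j k := nsq (dot (v k) (app L (u j))).
have E1 : \sum_j \sum_k r j * a j k <= complex.Re (op_tr (op_mul B rho)).
  rewrite (tr_mul_eigendec _ hr) Re_sum; apply: ler_sum => j _.
  rewrite Re_realM -mulr_sumr ler_wpM2l //.
  apply: le_trans (effect_square_le (u j) hB hB').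
  by rewrite (onb_norm _ hs.1).
(* Since [L] is Hermitian it can be moved onto [v k]; summing over [j] then gives the squared norm
   of [L v_k]. *)
have E2 : \sum_j \sum_k s k * b j k <= complex.Re (op_tr (op_mul L sigma)).
  rewrite (tr_mul_eigendec _ hs) Re_sum exchange_big; apply: ler_sum => k _ /=.
  rewrite Re_realM -mulr_sumr ler_wpM2l //.
  apply: le_trans (effect_square_le (v k) hL hL').
  rewrite (onb_norm _ hr.1) /=; apply: ler_sum => j _.
  by rewrite /b -nsqJ dotJ -hermitian_dot //; exact: hL.1.
apply: le_trans (_ : \sum_j \sum_k 2 * (r j * a j k + lam * (s k * b j k)) <= _).
  apply: ler_sum => j _; apply: ler_sum => k _.
  have h0 : 0 <= Num.min (r j) (lam * s k) by rewrite le_min r0 mulr_ge0.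
  have : nsq (dot (u j) (v k)) <= 2 * (a j k + b j k).
    rewrite -nsqJ dotJ /a /b /B app_op_idB dotBr.
    by apply: le_trans (nsqD_le _ _); rewrite subrK.
  move=> /(ler_wpM2r h0) /le_trans; apply.
  rewrite -mulrA ler_pM2l // mulrDl mulrA lerD // mulrC.
    by rewrite ler_wpM2r ?nsq_ge0 // ge_min lexx.
  by rewrite ler_wpM2r ?nsq_ge0 // ge_min lexx orbT.
under eq_bigr do rewrite -mulr_sumr big_split /= -[X in _ + X]mulr_sumr.
by rewrite -mulr_sumr big_split /= -[X in _ + X]mulr_sumr ler_pM2l // lerD // ler_wpM2l.
Qed.

(** Where [r > lam * s] the log-likelihood ratio is at least [ln lam]; elsewhere the left side is
    just [- s], and [xlnx_ge] suffices. *)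
Lemma relative_entropy_term (r s lam : R) : 0 <= r -> 0 <= s -> (s = 0 -> r = 0) -> 0 < lam ->
  (r - Num.min r (lam * s)) * Num.max 0 (ln lam) - s <= r * (ln r - ln s).
Proof.
move=> r0 s0 rs lam0.
have h := xlnx_ge r0 s0 rs.
have [hl|hl] := leP (ln lam) 0; first by rewrite mulr0; lra.
have [hm|hm] := leP r (lam * s); first by rewrite subrr mul0r; lra.
have rp : 0 < r by apply: le_lt_trans hm; rewrite mulr_ge0 // ltW.
have sp : 0 < s.
  by rewrite lt_neqAle s0 andbT eq_sym; apply/eqP => /rs h0; rewrite h0 ltxx in rp.
have : ln lam + ln s <= ln r.
  by rewrite -lnM ?posrE // ler_ln ?posrE ?mulr_gt0 // ltW.
rewrite -lerBrDr => /(ler_wpM2l r0).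
have : 0 <= lam * s * ln lam by rewrite !mulr_ge0 // ltW.
lra.
Qed.

(** The right side is the relative entropy of [rho] to [sigma], a sum over pairs [(j, k)] weighted
    by the overlaps. [relative_entropy_term] bounds each pair, the terms [- s k] add up to -1, and
    [nussbaum_szkola] bounds the sum of the minima. *)
Lemma testing_bound (T J K : finType) (rho sigma L : Op R T)
    (r : J -> R) (s : K -> R) u v (lam : R) :
  eigendec rho r u -> eigendec sigma s v ->
  (forall j, 0 <= r j) -> (forall k, 0 <= s k) ->
  \sum_j r j = 1 -> \sum_k s k = 1 ->
  (forall k, s k = 0 -> expect rho (v k) = 0) -> 0 < lam ->
  psd L -> psd (op_sub (@op_id R T) L) ->
  (1 - 2 * (complex.Re (op_tr (op_mul (op_sub (@op_id R T) L) rho)) +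
       lam * complex.Re (op_tr (op_mul L sigma)))) * Num.max 0 (ln lam) - 1 <=
  - \sum_k expect rho (v k) * ln (s k) - nent r.
Proof.
move=> hr hs r0 s0 r1 s1 supp lam0 hL hL'; set c := Num.max _ _.
have c0 : 0 <= c by rewrite le_max lexx.
have NS := nussbaum_szkola hr hs r0 s0 (ltW lam0) hL hL'.
set E := 2 * _ in NS *.
pose a j k := nsq (dot (u j) (v k)).
have ak j : \sum_k a j k = 1 by apply: onb_overlap_sumr; [exact: hr.1|exact: hs.1].
have aj k : \sum_j a j k = 1 by apply: onb_overlap_suml; [exact: hr.1|exact: hs.1].
have a0 j k : 0 <= a j k by exact: nsq_ge0.
have -> : - \sum_k expect rho (v k) * ln (s k) - nent r =
    \sum_j \sum_k a j k * (r j * (ln (r j) - ln (s k))).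
  rewrite /nent opprK addrC.
  under [RHS]eq_bigr do under eq_bigr do rewrite !mulrBr.
  under [RHS]eq_bigr do rewrite sumrB.
  rewrite sumrB; congr (_ - _).
    by apply: eq_bigr => j _; rewrite -mulr_suml ak mul1r.
  rewrite exchange_big; apply: eq_bigr => k _ /=.
  by rewrite (eigendec_expect _ hr) mulr_suml; apply: eq_bigr => j _; rewrite -/(a j k); ring.
apply: le_trans (_ : \sum_j \sum_k a j k * ((r j - Num.min (r j) (lam * s k)) * c - s k) <= _).
  have -> : \sum_j \sum_k a j k * ((r j - Num.min (r j) (lam * s k)) * c - s k) =
     (1 - \sum_j \sum_k a j k * Num.min (r j) (lam * s k)) * c - 1.
    under eq_bigr do under eq_bigr do rewrite mulrBr mulrA mulrBr.
    under eq_bigr do rewrite sumrB.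
    rewrite sumrB; congr (_ - _).
      under eq_bigr do rewrite -mulr_suml sumrB -mulr_suml ak mul1r.
      by rewrite -mulr_suml sumrB r1.
    rewrite exchange_big -s1; apply: eq_bigr => k _ /=.
    by rewrite -mulr_suml aj mul1r.
  by rewrite lerD2r ler_wpM2r // lerD2l lerN2.
apply: ler_sum => j _; apply: ler_sum => k _.
(* Pairs with zero overlap contribute nothing. For the others, [s k = 0] makes the expectation of
   [rho] at [v k] vanish, and this sum of nonnegative terms contains [r j] with positive weight. *)
have [->|aN0] := eqVneq (a j k) 0; first by rewrite !mul0r.
apply: ler_wpM2l => //; apply: relative_entropy_term => // sk0.
have /eqP := supp k sk0; rewrite (eigendec_expect _ hr) psumr_eq0 => [/allP /(_ j)|i _].
  by rewrite mem_index_enum => /(_ isT) /=; rewrite mulf_eq0 (negbTE aN0) orbF => /eqP.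
by rewrite mulr_ge0 // nsq_ge0.
Qed.

End HypothesisTesting.

(** * Product states, and the converse for a family of product states *)

Section TensorPower.
Variable R : realType.
Local Notation C := (R[i]).
Local Open Scope complex_scope.

Definition tensn (n : nat) (T : finType) (A : 'I_n -> Op R T) : Op R {ffun 'I_n -> T} :=
  fun s t => \prod_k A k (s k) (t k).

Definition vecn (n : nat) (T : finType) (x : 'I_n -> T -> C) : {ffun 'I_n -> T} -> C :=
  fun s => \prod_k x k (s k).

Lemma dot_vecn (n : nat) (T : finType) (x y : 'I_n -> T -> C) :
  dot (vecn x) (vecn y) = \prod_k dot (x k) (y k).
Proof.
rewrite /dot bigA_distr_bigA; apply: eq_bigr => f _.
by rewrite /vecn rmorph_prod -big_split.
Qed.

Lemma app_tensn (n : nat) (T : finType) (A : 'I_n -> Op R T) (x : 'I_n -> T -> C) :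
  app (tensn A) (vecn x) = vecn (fun k => app (A k) (x k)).
Proof.
apply/funext => s; rewrite /app /vecn bigA_distr_bigA; apply: eq_bigr => f _.
by rewrite -big_split.
Qed.

Lemma prodr_eqb (n : nat) (J : finType) (f g : {ffun 'I_n -> J}) :
  \prod_k (f k == g k)%:R = (f == g)%:R :> C.
Proof.
have [->|fg] := eqVneq f g; first by rewrite big1 // => k _; rewrite eqxx.
have /existsP[k hk] : [exists k, f k != g k].
  apply: contraNT fg => /existsPn h; apply/eqP/ffunP => k; apply/eqP.
  by have := h k; rewrite negbK.
by rewrite (bigD1 k) //= (negbTE hk) mul0r.
Qed.

(** Product vectors form an eigenbasis: each sum over words factors into sums over letters. *)
Lemma eigendec_tensn (n : nat) (T J : finType) (A : 'I_n -> Op R T)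
    (l : 'I_n -> J -> R) (u : 'I_n -> J -> T -> C) :
  (forall k, eigendec (A k) (l k) (u k)) ->
  eigendec (tensn A) (fun f : {ffun 'I_n -> J} => \prod_k l k (f k))
    (fun f => vecn (fun k => u k (f k))).
Proof.
move=> h; split; first split.
- move=> f g; rewrite dot_vecn -prodr_eqb; apply: eq_bigr => k _.
  exact: (h k).1.1.
- move=> s t; rewrite -prodr_eqb.
  transitivity (\prod_k \sum_j u k j (s k) * conjc (u k j (t k))).
    rewrite bigA_distr_bigA; apply: eq_bigr => f _.
    by rewrite /vecn rmorph_prod -big_split.
  by apply: eq_bigr => k _; rewrite (h k).1.2.
- move=> s t; rewrite /tensn.
  under eq_bigr do rewrite (h _).2.
  rewrite bigA_distr_bigA; apply: eq_bigr => f _.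
  by rewrite /vecn !rmorph_prod /= -!big_split.
Qed.

Lemma expect_tensn (n : nat) (T : finType) (A : 'I_n -> Op R T) (x : 'I_n -> T -> C) :
  (forall k, psd (A k)) -> expect (tensn A) (vecn x) = \prod_k expect (A k) (x k).
Proof.
move=> h; rewrite /expect app_tensn dot_vecn.
rewrite (eq_bigr (fun k => (expect (A k) (x k))%:C)); last first.
  by move=> k _; rewrite psd_expectC.
by rewrite -rmorph_prod.
Qed.

Lemma ln_prod (I : finType) (F : I -> R) :
  (forall i, 0 < F i) -> ln (\prod_i F i) = \sum_i ln (F i).
Proof.
move=> h; suff [] : ln (\prod_i F i) = \sum_i ln (F i) /\ 0 < \prod_i F i by [].
elim/big_ind2: _ => [|x a y b [<- a0] [<- b0]|i _]; rewrite ?ln1 //.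
by rewrite lnM // mulr_gt0.
Qed.

(** Additivity over the letters: the logarithm of the product is a sum, and in its [l]-th term the
    other factors of [g] sum to 1. Words with a zero factor of [s] have weight zero. *)
Lemma sum_prod_ln (n : nat) (J : finType) (g s : 'I_n -> J -> R) :
  (forall k, \sum_b g k b = 1) -> (forall k b, 0 <= s k b) ->
  (forall k b, s k b = 0 -> g k b = 0) ->
  \sum_(f : {ffun 'I_n -> J}) (\prod_k g k (f k)) * ln (\prod_k s k (f k)) =
  \sum_k \sum_b g k b * ln (s k b).
Proof.
move=> g1 s0 gs.
transitivity (\sum_(f : {ffun 'I_n -> J}) \sum_l (\prod_k g k (f k)) * ln (s l (f l))).
  apply: eq_bigr => f _; rewrite -mulr_sumr.
  have [/existsP[k /eqP hk]|/existsPn h] := boolP [exists k, s k (f k) == 0].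
    by rewrite (bigD1 k) //= gs // !mul0r.
  congr (_ * _); apply: ln_prod => k; rewrite lt_neqAle s0 andbT eq_sym; exact: h.
rewrite exchange_big; apply: eq_bigr => l _ /=.
(* The logarithm is absorbed into the [l]-th factor, so that the sum over words factors again. *)
transitivity (\sum_(f : {ffun 'I_n -> J}) \prod_k (g k (f k) * (if k == l then ln (s k (f k)) else 1))).
  apply: eq_bigr => f _; rewrite big_split /=; congr (_ * _).
  by rewrite -big_mkcond big_pred1_eq.
rewrite -(bigA_distr_bigA (fun k b => g k b * (if k == l then ln (s k b) else 1))) /=.
rewrite (bigD1 l) //= eqxx [X in _ * X]big1 ?mulr1 // => k /negbTE ->.
by under eq_bigr do rewrite mulr1.
Qed.

(** The complement of one element is the sum of the other elements. *)
Lemma povm_compl (M T : finType) (L : M -> Op R T) m : povm L -> psd (op_sub (@op_id R T) (L m)).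
Proof.
move=> [hL h1].
have E : op_sub (@op_id R T) (L m) = fun s t => \sum_(m' | m' != m) L m' s t.
  by apply/funext => s; apply/funext => t; rewrite /op_sub -h1 (bigD1 m) //= addrAC subrr add0r.
rewrite E; split=> [s t|v].
  by rewrite raddf_sum; apply: eq_bigr => m' _ /=; rewrite (hL m').1.
rewrite (eq_bigr (fun s => \sum_t \sum_(m' | m' != m) conjc (v s) * L m' s t * v t)); last first.
  by move=> s _; apply: eq_bigr => t _; rewrite mulr_sumr mulr_suml.
under eq_bigr do rewrite exchange_big.
by rewrite exchange_big; apply: sumr_ge0 => m' _ /=; exact: (hL m').2.
Qed.

(* Each message is tested against the product state [\otimes_k omega_k], whose
   factors are the letterwise averages: its success probabilities sum to one,
   and the relative entropies to it are additive over the letters. *)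
Lemma product_converse (n : nat) (M T : finType) (tau : M -> 'I_n -> Op R T)
    (L : M -> Op R {ffun 'I_n -> T}) (lam : R) :
  (forall m k, density (tau m k)) -> povm L -> (0 < #|M|)%N -> 0 < lam ->
  forall w E : R, w = #|M|%:R^-1 ->
  E = w * \sum_m complex.Re (op_tr (op_mul (op_sub (@op_id R _) (L m)) (tensn (tau m))))
      + lam * w ->
  (1 - 2 * E) * Num.max 0 (ln lam) - 1 <=
  \sum_k (ln 2 * vN_entropy (mix (fun _ => w) (tau^~ k))
          - w * \sum_m ln 2 * vN_entropy (tau m k)).
Proof.
move=> htau hL M0 lam0 w E wE EE; set c := Num.max 0 _.
have w0 : 0 < w by rewrite wE invr_gt0 ltr0n.
have w1 : \sum_(m : M) w = 1 by rewrite sumr_const -mulr_natl wE divff // pnatr_eq0 -lt0n.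
have hw : is_distr (fun _ : M => w) by split=> // _; exact: ltW.
pose om k := mix (fun _ => w) (tau^~ k).
have hom k : density (om k) by apply: mix_density.
have [s hs] := fin_all_exists (fun k => density_eigendec (hom k)).
have [v {}hs] := fin_all_exists hs.
have [r hr] := fin_all_exists (fun m => fin_all_exists (fun k => density_eigendec (htau m k))).
have [u {}hr] := fin_all_exists (fun m => fin_all_exists (hr m)).
have eigs := eigendec_tensn (fun k => let: And3 h _ _ := hs k in h).
have eigr m := eigendec_tensn (fun k => let: And3 h _ _ := hr m k in h).
have s0 k b : 0 <= s k b by case: (hs k).
have s1 k : \sum_b s k b = 1 by case: (hs k).
have r0 m k b : 0 <= r m k b by case: (hr m k).
have r1 m k : \sum_b r m k b = 1 by case: (hr m k).
pose g m k b := expect (tau m k) (v k b).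
have g0 m k b : 0 <= g m k b by apply: psd_expect_ge0; exact: (htau m k).1.
(* The diagonals of the [tau m k] in the eigenbasis of their average [om k] average to its
   spectrum. *)
have gs k b : \sum_m w * g m k b = s k b.
  by rewrite -mix_expect; apply: eigendec_expect_eigenvector; case: (hs k).
(* All weights [w] are positive, so a zero of the average is a zero of every term; this is the
   support condition of [testing_bound]. *)
have supp m k b : s k b = 0 -> g m k b = 0.
  rewrite -gs => /eqP; rewrite psumr_eq0 => [/allP /(_ m)|m' _].
    by rewrite mem_index_enum => /(_ isT) /=; rewrite mulf_eq0 gt_eqF //= => /eqP.
  by rewrite mulr_ge0 // ltW.
have g1 m k : \sum_b g m k b = 1.
  case: (hr m k) => hu _ hr1; rewrite -hr1 /g.
  under eq_bigr do rewrite (eigendec_expect _ hu).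
  rewrite exchange_big; apply: eq_bigr => j _ /=.
  rewrite -mulr_sumr onb_overlap_sumr ?mulr1 //; first exact: hu.1.
  by case: (hs k) => -[].
have prod1 (h : 'I_n -> T -> R) : (forall k, \sum_b h k b = 1) ->
    \sum_(f : {ffun 'I_n -> T}) \prod_k h k (f k) = 1.
  by move=> h1; rewrite -bigA_distr_bigA big1.
have gE m (f : {ffun 'I_n -> T}) :
    expect (tensn (tau m)) (vecn (fun k => v k (f k))) = \prod_k g m k (f k).
  by rewrite expect_tensn // => k; exact: (htau m k).1.
pose beta m := complex.Re (op_tr (op_mul (L m) (tensn om))).
(* The reference state does not depend on the message, so the elements of the measurement sum to its
   trace. *)
have beta1 : \sum_m beta m = 1.
  rewrite /beta -Re_sum.
  have -> : \sum_m op_tr (op_mul (L m) (tensn om)) = op_tr (tensn om).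
    rewrite /op_tr exchange_big; apply: eq_bigr => x _; rewrite /op_mul exchange_big /=.
    rewrite (bigD1 x) //= -mulr_suml hL.2 /op_id eqxx mul1r big1 ?addr0 // => y.
    by rewrite -mulr_suml hL.2 /op_id eq_sym => /negbTE ->; rewrite mul0r.
  by rewrite (tr_eigendec eigs) /= prod1.
have prod0 (h : 'I_n -> T -> R) : (forall k b, 0 <= h k b) ->
    forall f : {ffun 'I_n -> T}, 0 <= \prod_k h k (f k).
  by move=> h0 f; apply: prodr_ge0.
have key m := testing_bound (eigr m) eigs (prod0 _ (r0 m)) (prod0 _ s0)
  (prod1 _ (r1 m)) (prod1 _ s1).
pose e m := complex.Re (op_tr (op_mul (op_sub (@op_id R _) (L m)) (tensn (tau m)))).
(* The bound is affine in the errors, so averaging over the messages costs nothing; [beta1] makes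
   the second error contribute [lam * w]. *)
have -> : (1 - 2 * E) * c - 1 = \sum_m w * ((1 - 2 * (e m + lam * beta m)) * c - 1).
  have -> : E = \sum_m w * (e m + lam * beta m).
    by rewrite EE -mulr_sumr big_split -mulr_sumr beta1 mulr1 mulrDr [w * lam]mulrC.
  under [RHS]eq_bigr do rewrite mulrBr mulr1 mulrA mulrBr mulr1.
  rewrite sumrB w1 -mulr_suml sumrB w1 mulr_sumr; congr ((_ - _) * _ - _).
  by apply: eq_bigr => m _; rewrite mulrCA.
(* The average relative entropy to the average state is the Holevo quantity, letter by letter. *)
have -> : \sum_k (ln 2 * vN_entropy (om k) - w * \sum_m ln 2 * vN_entropy (tau m k)) =
   \sum_m w * (- \sum_k \sum_b g m k b * ln (s k b) - \sum_k nent (r m k)).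
  transitivity (\sum_k \sum_m w * (- (\sum_b g m k b * ln (s k b)) - nent (r m k))).
    apply: eq_bigr => k _; under [RHS]eq_bigr do rewrite mulrBr.
    rewrite sumrB; congr (_ - _).
      case: (hs k) => /vN_entropyE -> _ _; rewrite /nent.
      under [RHS]eq_bigr do rewrite mulrN mulr_sumr.
      rewrite sumrN exchange_big; congr (- _); apply: eq_bigr => b _ /=.
      by rewrite -gs mulr_suml; apply: eq_bigr => m _; rewrite gs mulrA.
    rewrite mulr_sumr; apply: eq_bigr => m _.
    by case: (hr m k) => /vN_entropyE -> _ _.
  rewrite exchange_big; apply: eq_bigr => m _ /=.
  by rewrite -mulr_sumr sumrB sumrN.
apply: ler_sum => m _; rewrite ler_pM2l //.
apply: le_trans (key (L m) lam m _ lam0 (hL.1 m) (povm_compl m hL)) _.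
  move=> f /eqP; rewrite prodf_seq_eq0 => /hasP[k _ /= /eqP hk].
  by rewrite gE (bigD1 k) //= supp // mul0r.
under eq_bigr do rewrite gE.
rewrite sum_prod_ln //; last exact: supp.
rewrite lerD2l lerN2 /nent sum_prod_ln // sumrN //.
Qed.

End TensorPower.

(** * Entropy of classical-quantum states, partial traces and relabelings *)

Section ClassicalQuantum.
Variable R : realType.
Local Notation C := (R[i]).
Local Open Scope complex_scope.

Lemma sum_pair (V : nmodType) (I J : finType) (F : I * J -> V) :
  \sum_p F p = \sum_i \sum_j F (i, j).
Proof. by rewrite pair_bigA; apply: eq_bigr => -[]. Qed.

(** Chain rule for a block-diagonal state: the eigenvectors of the block [c], extended by zero, have
    eigenvalues [w c * l c b]. The bijection [h] allows the classical and quantum registers to occur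
    in any order. *)
Lemma vN_entropy_cq (K I B : finType) (A : Op R K) (h : I -> B -> K)
    (w : I -> R) (tau : I -> Op R B) :
  bijective (fun z : I * B => h z.1 z.2) -> (forall c, 0 <= w c) ->
  (forall c, density (tau c)) ->
  (forall c b c' b', A (h c b) (h c' b') = (c == c')%:R * (w c)%:C * tau c b b') ->
  ln 2 * vN_entropy A = nent w + \sum_c w c * (ln 2 * vN_entropy (tau c)).
Proof.
move=> [hi hK Kh] w0 htau hA.
have hh k : h (hi k).1 (hi k).2 = k by exact: Kh.
have [l hl] := fin_all_exists (fun c => density_eigendec (htau c)).
have [u {}hl] := fin_all_exists hl.
have onbu c : onb (u c) by case: (hl c) => -[].
have E : eigendec A (fun z : I * B => w z.1 * l z.1 z.2)
    (fun z k => ((z.1 == (hi k).1)%:R * u z.1 z.2 (hi k).2)).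
  split; first split.
  - move=> [c b] [c' b'] /=; rewrite /dot (reindex (fun z : I * B => h z.1 z.2) (onW_bij _ (Bijective hK Kh))) sum_pair /=.
    rewrite (bigD1 c) //= [X in _ + X]big1 ?addr0 => [|d dc]; last first.
      rewrite big1 // => e _; rewrite (hK (d, e)) /= [c == d]eq_sym (negbTE dc) mul0r.
      by rewrite conjc0 mul0r.
    transitivity ((c == c')%:R * dot (u c b) (u c' b')).
      rewrite mulr_sumr; apply: eq_bigr => e _; rewrite (hK (c, e)) /= eqxx mul1r.
      by rewrite [c' == c]eq_sym; ring.
    rewrite xpair_eqE; case: eqP => [<-|_]; last by rewrite mul0r.
    by rewrite mul1r (onbu c).1.
  - move=> s t; rewrite sum_pair /= (bigD1 (hi s).1) //= [X in _ + X]big1 ?addr0 => [|d dc]; last first.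
      by rewrite big1 // => e _; rewrite (negbTE dc) !mul0r.
    rewrite eqxx.
    under eq_bigr do rewrite mul1r conjcM conjc_nat mulrCA.
    rewrite -mulr_sumr (onbu _).2 -natrM mulnb -(can_eq Kh).
    by case: (hi s) (hi t) => [c b] [c' b'].
  - move=> s t; rewrite -[s in LHS]hh -[t in LHS]hh hA sum_pair /=.
    rewrite (bigD1 (hi s).1) //= [X in _ + X]big1 ?addr0 => [|d dc]; last first.
      by rewrite big1 // => e _; rewrite (negbTE dc) !mul0r mulr0.
    case: (hl (hi s).1) => -[_ ->] _ _; rewrite mulr_sumr; apply: eq_bigr => b _.
    by rewrite eqxx conjcM conjc_nat rmorphM /=; ring.
rewrite (vN_entropyE E) /nent sum_pair /= -sumrN -sumrN -big_split; apply: eq_bigr => c _ /=.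
case: (hl c) => /vN_entropyE -> l0 l1; rewrite /nent mulrN -opprD; congr (- _).
(* The logarithm of a product splits only for positive factors; with a zero factor both sides
   vanish. *)
have [->|wc0] := eqVneq (w c) 0.
  by rewrite !mul0r addr0 big1 // => b _; rewrite !mul0r.
rewrite -[w c * ln _]mulr1 -l1 mulr_sumr mulr_sumr -big_split; apply: eq_bigr => b _ /=.
have [->|lb0] := eqVneq (l c b) 0; first by rewrite !(mulr0, mul0r) addr0.
have lbp : 0 < l c b by rewrite lt_neqAle eq_sym lb0 l0.
have wcp : 0 < w c by rewrite lt_neqAle eq_sym wc0 w0.
by rewrite lnM ?posrE //; ring.
Qed.

Lemma ptrace_split (T K J : finType) (k : T -> K) (r : T -> J) (g : K -> J -> T) (A : Op R T) a b :
  (forall a j, k (g a j) = a) -> (forall a j, r (g a j) = j) -> (forall t, g (k t) (r t) = t) ->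
  ptrace k r A a b = \sum_j A (g a j) (g b j).
Proof.
move=> kg rg gK; rewrite /ptrace (reindex_onto (g a) r) => [|t /eqP <-]; last exact: gK.
apply: eq_big => [j|j _]; first by rewrite kg rg !eqxx.
rewrite (big_pred1 (g b j)) // => t; rewrite rg; apply/andP/eqP => [[/eqP <- /eqP ->]|->].
  by rewrite gK.
by rewrite kg rg !eqxx.
Qed.

(** Common form of all entropies in the three informations: [g] rebuilds a full label from its kept
    and traced parts, while [h] and [h'] translate between kept labels and pairs of a classical and
    a quantum part. *)
Lemma Hred_cq (T K J I B : finType) (th : Op R T) (k : T -> K) (r : T -> J)
    (g : K -> J -> T) (h : I -> B -> K) (h' : K -> I * B)
    (w : I -> R) (tau : I -> Op R B) :
  (forall a j, k (g a j) = a) -> (forall a j, r (g a j) = j) -> (forall t, g (k t) (r t) = t) ->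
  (forall c b, h' (h c b) = (c, b)) -> (forall a, h (h' a).1 (h' a).2 = a) ->
  (forall c, 0 <= w c) -> (forall c, density (tau c)) ->
  (forall c b c' b',
     \sum_j th (g (h c b) j) (g (h c' b') j) = (c == c')%:R * (w c)%:C * tau c b b') ->
  ln 2 * Hred th k r = nent w + \sum_c w c * (ln 2 * vN_entropy (tau c)).
Proof.
move=> kg rg gK hK Kh w0 htau hth; apply: (vN_entropy_cq (h := h)) => //.
  by exists h' => [[c b]|a] /=; rewrite ?hK.
by move=> c b c' b'; rewrite (ptrace_split (g := g)).
Qed.

Lemma sum_unit (V : nmodType) (F : unit -> V) : \sum_i F i = F tt.
Proof. by rewrite (big_pred1 tt) // => -[]. Qed.

(** The state of a trivial system, which makes purely classical marginals instances of [Hred_cq]. *)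
Definition op1 : Op R unit := fun _ _ => 1.

Lemma op1_eigendec : eigendec op1 (fun _ : unit => 1) (fun _ _ => 1).
Proof.
split; first split.
- by move=> [] []; rewrite /dot sum_unit conjc1 mulr1.
- by move=> [] []; rewrite sum_unit conjc1 mulr1.
- by move=> [] []; rewrite sum_unit conjc1 !mulr1.
Qed.

Lemma op1_density : density op1.
Proof.
split; first by apply: eigendec_psd op1_eigendec _ => _; exact: ler01.
by rewrite /op_tr sum_unit.
Qed.

Lemma vN_entropy_op1 : ln 2 * vN_entropy op1 = 0.
Proof. by rewrite (vN_entropyE op1_eigendec) /nent sum_unit ln1 mulr0 oppr0. Qed.

Definition ptr1 (B1 B2 : finType) (A : Op R (B1 * B2)%type) : Op R B1 :=
  fun b b' => \sum_c A (b, c) (b', c).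

Definition ptr2 (B1 B2 : finType) (A : Op R (B1 * B2)%type) : Op R B2 :=
  fun b b' => \sum_c A (c, b) (c, b').

Definition relabel (S T : finType) (f : S -> T) (A : Op R T) : Op R S :=
  fun s t => A (f s) (f t).

Lemma relabel_psd (S T : finType) (f : S -> T) (A : Op R T) :
  bijective f -> psd A -> psd (relabel f A).
Proof.
move=> [g fK gK] [hA hp]; split; first by move=> s t; exact: hA.
move=> v; have := hp (v \o g).
rewrite (reindex f) /=; last by apply: onW_bij; exists g.
congr (_ <= _); apply: eq_bigr => s _.
rewrite (reindex f) /=; last by apply: onW_bij; exists g.
by apply: eq_bigr => t _; rewrite !fK.
Qed.

Lemma relabel_tr (S T : finType) (f : S -> T) (A : Op R T) :
  bijective f -> op_tr (relabel f A) = op_tr A.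
Proof. by move=> hf; rewrite /op_tr [RHS](reindex f) //; apply: onW_bij. Qed.

Lemma relabel_mul (S T : finType) (f : S -> T) (A B : Op R T) :
  bijective f -> op_mul (relabel f A) (relabel f B) = relabel f (op_mul A B).
Proof.
move=> hf; apply/funext => s; apply/funext => t.
by rewrite /relabel /op_mul [RHS](reindex f) //; apply: onW_bij.
Qed.

Lemma relabel_density (S T : finType) (f : S -> T) (A : Op R T) :
  bijective f -> density A -> density (relabel f A).
Proof. by move=> hf [h1 h2]; split; [exact: relabel_psd|rewrite relabel_tr]. Qed.

Lemma ptr1_psd (B1 B2 : finType) (A : Op R (B1 * B2)%type) : psd A -> psd (ptr1 A).
Proof.
move=> [hA hp]; split=> [s t|v].
  by rewrite /ptr1 raddf_sum; apply: eq_bigr => c _; exact: hA.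
have E : \sum_s \sum_t conjc (v s) * ptr1 A s t * v t =
    \sum_c \sum_s \sum_t conjc (v s) * A (s, c) (t, c) * v t.
  rewrite [RHS]exchange_big; apply: eq_bigr => s _.
  rewrite [RHS]exchange_big; apply: eq_bigr => t _ /=.
  by rewrite /ptr1 mulr_sumr mulr_suml.
rewrite E; apply: sumr_ge0 => c _.
(* Positivity of [A] is used on the tensor product of [v] with the basis vector [c]. *)
have := hp (fun x => (x.2 == c)%:R * v x.1); rewrite sum_pair.
congr (_ <= _); apply: eq_bigr => s _ /=.
rewrite (bigD1 c) //= [X in _ + X]big1 ?addr0 => [|d dc]; last first.
  by rewrite big1 // => x _; rewrite (negbTE dc) mul0r conjc0 !mul0r.
rewrite sum_pair; apply: eq_bigr => t _ /=.
rewrite (bigD1 c) //= [X in _ + X]big1 ?addr0 => [|d dc]; last first.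
  by rewrite (negbTE dc) mul0r mulr0.
by rewrite eqxx !mul1r.
Qed.

Lemma ptr1_tr (B1 B2 : finType) (A : Op R (B1 * B2)%type) : op_tr (ptr1 A) = op_tr A.
Proof. by rewrite /op_tr sum_pair. Qed.

Lemma ptr1_density (B1 B2 : finType) (A : Op R (B1 * B2)%type) : density A -> density (ptr1 A).
Proof. by move=> [h1 h2]; split; [exact: ptr1_psd|rewrite ptr1_tr]. Qed.

Lemma swap_bij (S T : Type) : bijective (fun x : S * T => (x.2, x.1)).
Proof. by exists (fun x => (x.2, x.1)) => -[]. Qed.

Lemma ptr2_density (B1 B2 : finType) (A : Op R (B1 * B2)%type) : density A -> density (ptr2 A).
Proof. by move=> /(relabel_density (@swap_bij B2 B1)) /ptr1_density. Qed.

End ClassicalQuantum.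

(** * The three mutual informations of [theta] as averaged Holevo quantities *)

Section SatoInformation.
Variable R : realType.
Local Notation C := (R[i]).
Local Open Scope complex_scope.

(* [ln 2] times the conditional Holevo information [I(X; T | Y)]. *)
Definition cinfo (X Y T : finType) (sig : X -> Y -> Op R T) (p : X -> R) (q : Y -> R) : R :=
  \sum_y q y * (ln 2 * vN_entropy (mix p (sig^~ y))
                - \sum_x p x * (ln 2 * vN_entropy (sig x y))).

Variables (X1 X2 B1 B2 Q : finType) (rho : X1 -> X2 -> Op R (B1 * B2)%type).
Hypothesis hrho : forall x1 x2, density (rho x1 x2).
Variables (pQ : Q -> R) (p1 : Q -> X1 -> R) (p2 : Q -> X2 -> R).
Hypotheses (hQ : is_distr pQ) (h1 : forall q, is_distr (p1 q)) (h2 : forall q, is_distr (p2 q)).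
Local Notation th := (theta rho pQ p1 p2).

Definition sig1 x1 x2 : Op R B1 := ptr1 (rho x1 x2).
(** The receiver's own input comes first and the conditioning input second, as [cinfo] expects. *)
Definition sig2 x2 x1 : Op R B2 := ptr2 (rho x1 x2).
(* The dummy input makes the bound on the sum rate an instance of [cinfo]. *)
Definition sig12 (x : X1 * X2) (_ : unit) : Op R (B1 * B2)%type := rho x.1 x.2.

Lemma theta_tr x1 x2 : \sum_b1 \sum_b2 rho x1 x2 (b1, b2) (b1, b2) = 1.
Proof. by have := (hrho x1 x2).2; rewrite /op_tr sum_pair. Qed.

Lemma theta_tr_sum (X : finType) (p : X -> R) (f : X -> X1) (g : X -> X2) : is_distr p ->
  \sum_x (p x)%:C * (\sum_b1 \sum_b2 rho (f x) (g x) (b1, b2) (b1, b2)) = 1.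
Proof.
move=> [_ p1']; under eq_bigr do rewrite theta_tr mulr1.
by rewrite -rmorph_sum p1'.
Qed.

Lemma prod_distr q : is_distr (fun x : X1 * X2 => p1 q x.1 * p2 q x.2).
Proof.
split=> [x|]; first by rewrite mulr_ge0 ?(h1 q).1 ?(h2 q).1.
rewrite sum_pair /=; under eq_bigr do rewrite -mulr_sumr (h2 q).2 mulr1.
exact: (h1 q).2.
Qed.

(** Joint laws of the classical registers; with [pQ] they are the block weights of the reduced
    states below. *)
Let w3 (c : X1 * X2 * Q) := pQ c.2 * p1 c.2 c.1.1 * p2 c.2 c.1.2.
Let w2 (c : X2 * Q) := pQ c.2 * p2 c.2 c.1.
Let w1 (c : X1 * Q) := pQ c.2 * p1 c.2 c.1.

Let w3_ge0 c : 0 <= w3 c.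
Proof. by rewrite !mulr_ge0 //; [exact: hQ.1 | exact: (h1 _).1 | exact: (h2 _).1]. Qed.

Let w2_ge0 c : 0 <= w2 c.
Proof. by rewrite mulr_ge0 //; [exact: hQ.1 | exact: (h2 _).1]. Qed.

Let w1_ge0 c : 0 <= w1 c.
Proof. by rewrite mulr_ge0 //; [exact: hQ.1 | exact: (h1 _).1]. Qed.

(** Labels are nested tuples; once they are taken apart, the inverse laws of the relabelings hold by
    computation. *)
Local Ltac destruct_pairs :=
  intros; repeat match goal with
  | x : ?A |- _ => lazymatch eval hnf in A with
                   | prod _ _ => destruct x
                   | unit => destruct x
                   end
  end.

Local Ltac diagonal q q' := 
  rewrite /= ?xpair_eqE ?eqxx ?rmorphM /=; case: (q == q') => /=.

(** Here and in the next lemmas the first function puts kept and traced labels back into the order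
    of [theta]. Registers that are traced out disappear because the states and the input laws are
    normalized. *)
Lemma H_X1X2Q :
  ln 2 * Hred th (fun t => (lX1 t, lX2 t, lQ t)) (fun t => (lB1 t, lB2 t)) = nent w3.
Proof.
rewrite (@Hred_cq _ _ _ _ _ unit th _ _ (fun a j => (a.2, a.1.1, a.1.2, j.1, j.2))
  (fun c _ => c) (fun a => (a, tt)) w3 (fun _ => @op1 R)) //; try by destruct_pairs.
- by rewrite big1 ?addr0 // => c _; rewrite vN_entropy_op1 mulr0.
- by move=> c; exact: op1_density.
- move=> [[x1 x2] q] b [[x1' x2'] q'] b' /=; rewrite sum_pair.
  rewrite /op1 -(theta_tr x1 x2) mulr_sumr; apply: eq_bigr => b1 _.
  rewrite mulr_sumr; apply: eq_bigr => b2 _; rewrite /w3.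
  by diagonal q q'; case: (x1 == x1'); case: (x2 == x2') => /=; ring.
Qed.

Lemma H_X2X1Q :
  ln 2 * Hred th (fun t => (lX2 t, lX1 t, lQ t)) (fun t => (lB1 t, lB2 t)) = nent w3.
Proof.
rewrite (@Hred_cq _ _ _ _ _ unit th _ _ (fun a j => (a.2, a.1.2, a.1.1, j.1, j.2))
  (fun c _ => (c.1.2, c.1.1, c.2)) (fun a => ((a.1.2, a.1.1, a.2), tt)) w3 (fun _ => @op1 R)) //;
  try by destruct_pairs.
- by rewrite big1 ?addr0 // => c _; rewrite vN_entropy_op1 mulr0.
- by move=> c; exact: op1_density.
- move=> [[x1 x2] q] b [[x1' x2'] q'] b' /=; rewrite sum_pair.
  rewrite /op1 -(theta_tr x1 x2) mulr_sumr; apply: eq_bigr => b1 _.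
  rewrite mulr_sumr; apply: eq_bigr => b2 _; rewrite /w3.
  by diagonal q q'; case: (x1 == x1'); case: (x2 == x2') => /=; ring.
Qed.

Lemma H_X2Q :
  ln 2 * Hred th (fun t => (lX2 t, lQ t)) (fun t => (lX1 t, lB1 t, lB2 t)) = nent w2.
Proof.
rewrite (@Hred_cq _ _ _ _ _ unit th _ _ (fun a j => (a.2, j.1.1, a.1, j.1.2, j.2))
  (fun c _ => c) (fun a => (a, tt)) w2 (fun _ => @op1 R)) //; try by destruct_pairs.
- by rewrite big1 ?addr0 // => c _; rewrite vN_entropy_op1 mulr0.
- by move=> c; exact: op1_density.
- move=> [x2 q] b [x2' q'] b' /=; rewrite !sum_pair.
  rewrite /op1 -(@theta_tr_sum _ (p1 q) id (fun _ => x2) (h1 q)) mulr_sumr; apply: eq_bigr => x1 _.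
  rewrite !mulr_sumr; apply: eq_bigr => b1 _.
  rewrite !mulr_sumr; apply: eq_bigr => b2 _; rewrite /w2.
  by diagonal q q'; case: (x2 == x2') => /=; ring.
Qed.

Lemma H_X1Q :
  ln 2 * Hred th (fun t => (lX1 t, lQ t)) (fun t => (lX2 t, lB1 t, lB2 t)) = nent w1.
Proof.
rewrite (@Hred_cq _ _ _ _ _ unit th _ _ (fun a j => (a.2, a.1, j.1.1, j.1.2, j.2))
  (fun c _ => c) (fun a => (a, tt)) w1 (fun _ => @op1 R)) //; try by destruct_pairs.
- by rewrite big1 ?addr0 // => c _; rewrite vN_entropy_op1 mulr0.
- by move=> c; exact: op1_density.
- move=> [x1 q] b [x1' q'] b' /=; rewrite !sum_pair.
  rewrite /op1 -(@theta_tr_sum _ (p2 q) (fun _ => x1) id (h2 q)) mulr_sumr; apply: eq_bigr => x2 _.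
  rewrite !mulr_sumr; apply: eq_bigr => b1 _.
  rewrite !mulr_sumr; apply: eq_bigr => b2 _; rewrite /w1.
  by diagonal q q'; case: (x1 == x1') => /=; ring.
Qed.

Lemma H_Q :
  ln 2 * Hred th (fun t => lQ t) (fun t => (lX1 t, lX2 t, lB1 t, lB2 t)) = nent pQ.
Proof.
rewrite (@Hred_cq _ _ _ _ _ unit th _ _ (fun a j => (a, j.1.1.1, j.1.1.2, j.1.2, j.2))
  (fun c _ => c) (fun a => (a, tt)) pQ (fun _ => @op1 R)) //; try by destruct_pairs.
- by rewrite big1 ?addr0 // => c _; rewrite vN_entropy_op1 mulr0.
- exact: hQ.1.
- by move=> c; exact: op1_density.
- move=> q b q' b' /=; rewrite !sum_pair.
  rewrite /op1 -(@theta_tr_sum _ _ fst snd (prod_distr q)) sum_pair mulr_sumr; apply: eq_bigr => x1 _.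
  rewrite !mulr_sumr; apply: eq_bigr => x2 _ /=.
  rewrite !mulr_sumr; apply: eq_bigr => b1 _.
  rewrite !mulr_sumr; apply: eq_bigr => b2 _.
  by diagonal q q'; ring.
Qed.

(** Given [Q] the inputs are independent, so tracing out [X1] leaves blocks that are mixtures with
    law [p1]. *)
Lemma H_B1X2Q :
  ln 2 * Hred th (fun t => (lB1 t, lX2 t, lQ t)) (fun t => (lX1 t, lB2 t)) =
  nent w2 + \sum_c w2 c * (ln 2 * vN_entropy (mix (p1 c.2) (sig1^~ c.1))).
Proof.
apply: (@Hred_cq _ _ _ _ _ B1 th _ _ (fun a j => (a.2, j.1, a.1.2, a.1.1, j.2))
  (fun c b => (b, c.1, c.2)) (fun a => ((a.1.2, a.2), a.1.1)) w2
  (fun c => mix (p1 c.2) (sig1^~ c.1))) => //; try by destruct_pairs.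
- by move=> c; apply: mix_density => // x1; exact: ptr1_density.
- move=> [x2 q] b [x2' q'] b' /=; rewrite sum_pair /mix mulr_sumr; apply: eq_bigr => x1 _.
  rewrite /sig1 /ptr1 !mulr_sumr; apply: eq_bigr => b2 _; rewrite /w2.
  by diagonal q q'; case: (x2 == x2') => /=; ring.
Qed.

Lemma H_B2X1Q :
  ln 2 * Hred th (fun t => (lB2 t, lX1 t, lQ t)) (fun t => (lX2 t, lB1 t)) =
  nent w1 + \sum_c w1 c * (ln 2 * vN_entropy (mix (p2 c.2) (sig2^~ c.1))).
Proof.
apply: (@Hred_cq _ _ _ _ _ B2 th _ _ (fun a j => (a.2, a.1.2, j.1, j.2, a.1.1))
  (fun c b => (b, c.1, c.2)) (fun a => ((a.1.2, a.2), a.1.1)) w1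
  (fun c => mix (p2 c.2) (sig2^~ c.1))) => //; try by destruct_pairs.
- by move=> c; apply: mix_density => // x2; exact: ptr2_density.
- move=> [x1 q] b [x1' q'] b' /=; rewrite sum_pair /mix mulr_sumr; apply: eq_bigr => x2 _.
  rewrite /sig2 /ptr2 !mulr_sumr; apply: eq_bigr => b1 _; rewrite /w1.
  by diagonal q q'; case: (x1 == x1') => /=; ring.
Qed.

Lemma H_B1B2Q :
  ln 2 * Hred th (fun t => (lB1 t, lB2 t, lQ t)) (fun t => (lX1 t, lX2 t)) =
  nent pQ + \sum_q pQ q *
    (ln 2 * vN_entropy (mix (fun x => p1 q x.1 * p2 q x.2) (sig12^~ tt))).
Proof.
apply: (@Hred_cq _ _ _ _ _ (B1 * B2)%type th _ _ (fun a j => (a.2, j.1, j.2, a.1.1, a.1.2))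
  (fun c b => (b.1, b.2, c)) (fun a => (a.2, a.1)) pQ
  (fun q => mix (fun x => p1 q x.1 * p2 q x.2) (sig12^~ tt))) => //; try by destruct_pairs.
- exact: hQ.1.
- by move=> c; apply: mix_density; [exact: prod_distr | move=> x; exact: hrho].
- move=> q [b1 b2] q' [b1' b2'] /=; rewrite /mix mulr_sumr; apply: eq_bigr => -[x1 x2] _.
  by rewrite /sig12; diagonal q q'; ring.
Qed.

Lemma H_X1B1X2Q :
  ln 2 * Hred th (fun t => (lX1 t, lB1 t, lX2 t, lQ t)) (fun t => lB2 t) =
  nent w3 + \sum_c w3 c * (ln 2 * vN_entropy (sig1 c.1.1 c.1.2)).
Proof.
apply: (@Hred_cq _ _ _ _ _ B1 th _ _ (fun a j => (a.2, a.1.1.1, a.1.2, a.1.1.2, j))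
  (fun c b => (c.1.1, b, c.1.2, c.2)) (fun a => ((a.1.1.1, a.1.2, a.2), a.1.1.2)) w3
  (fun c => sig1 c.1.1 c.1.2)) => //; try by destruct_pairs.
- by move=> c; exact: ptr1_density.
- move=> [[x1 x2] q] b [[x1' x2'] q'] b' /=.
  rewrite /sig1 /ptr1 !mulr_sumr; apply: eq_bigr => b2 _; rewrite /w3.
  by diagonal q q'; case: (x1 == x1'); case: (x2 == x2') => /=; ring.
Qed.

Lemma H_X2B2X1Q :
  ln 2 * Hred th (fun t => (lX2 t, lB2 t, lX1 t, lQ t)) (fun t => lB1 t) =
  nent w3 + \sum_c w3 c * (ln 2 * vN_entropy (sig2 c.1.2 c.1.1)).
Proof.
apply: (@Hred_cq _ _ _ _ _ B2 th _ _ (fun a j => (a.2, a.1.2, a.1.1.1, j, a.1.1.2))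
  (fun c b => (c.1.2, b, c.1.1, c.2)) (fun a => ((a.1.2, a.1.1.1, a.2), a.1.1.2)) w3
  (fun c => sig2 c.1.2 c.1.1)) => //; try by destruct_pairs.
- by move=> c; exact: ptr2_density.
- move=> [[x1 x2] q] b [[x1' x2'] q'] b' /=.
  rewrite /sig2 /ptr2 !mulr_sumr; apply: eq_bigr => b1 _; rewrite /w3.
  by diagonal q q'; case: (x1 == x1'); case: (x2 == x2') => /=; ring.
Qed.

Lemma H_X1X2B1B2Q :
  ln 2 * Hred th (fun t => (lX1 t, lX2 t, lB1 t, lB2 t, lQ t)) (fun _ => tt) =
  nent w3 + \sum_c w3 c * (ln 2 * vN_entropy (rho c.1.1 c.1.2)).
Proof.
apply: (@Hred_cq _ _ _ _ _ (B1 * B2)%type th _ _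
  (fun a _ => (a.2, a.1.1.1.1, a.1.1.1.2, a.1.1.2, a.1.2))
  (fun c b => (c.1.1, c.1.2, b.1, b.2, c.2))
  (fun a => ((a.1.1.1.1, a.1.1.1.2, a.2), (a.1.1.2, a.1.2))) w3
  (fun c => rho c.1.1 c.1.2)) => //; try by destruct_pairs.
- move=> [[x1 x2] q] [b1 b2] [[x1' x2'] q'] [b1' b2'] /=; rewrite sum_unit /w3.
  by diagonal q q'; case: (x1 == x1'); case: (x2 == x2') => /=; ring.
Qed.

Let ln2_mul (a b c d : R) :
  ln 2 * (a + b - c - d) = ln 2 * a + ln 2 * b - ln 2 * c - ln 2 * d.
Proof. by ring. Qed.

(** The classical entropies [nent w3] and [nent w2] occur once with each sign and cancel; the rest
    is grouped by [q] and [x2]. *)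
Lemma I1_theta : ln 2 * I_X1_B1_given_X2Q th = \sum_q pQ q * cinfo sig1 (p1 q) (p2 q).
Proof.
rewrite /I_X1_B1_given_X2Q ln2_mul H_X1X2Q H_B1X2Q H_X1B1X2Q H_X2Q.
transitivity (\sum_c w2 c * (ln 2 * vN_entropy (mix (p1 c.2) (sig1^~ c.1)))
   - \sum_c w3 c * (ln 2 * vN_entropy (sig1 c.1.1 c.1.2))); first by ring.
rewrite sum_pair exchange_big /= [X in _ - X]sum_pair [X in _ - X]exchange_big /= -sumrB; apply: eq_bigr => q _.
rewrite [X in _ - X]sum_pair [X in _ - X]exchange_big -sumrB /cinfo mulr_sumr; apply: eq_bigr => x2 _ /=.
rewrite [RHS]mulrA [RHS]mulrBr; congr (_ - _); rewrite !mulr_sumr; apply: eq_bigr => x1 _.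
by rewrite /w3 /=; ring.
Qed.

Lemma I2_theta : ln 2 * I_X2_B2_given_X1Q th = \sum_q pQ q * cinfo sig2 (p2 q) (p1 q).
Proof.
rewrite /I_X2_B2_given_X1Q ln2_mul H_X2X1Q H_B2X1Q H_X2B2X1Q H_X1Q.
transitivity (\sum_c w1 c * (ln 2 * vN_entropy (mix (p2 c.2) (sig2^~ c.1)))
   - \sum_c w3 c * (ln 2 * vN_entropy (sig2 c.1.2 c.1.1))); first by ring.
rewrite sum_pair exchange_big /= [X in _ - X]sum_pair [X in _ - X]exchange_big /= -sumrB; apply: eq_bigr => q _.
rewrite [X in _ - X]sum_pair -sumrB /cinfo mulr_sumr; apply: eq_bigr => x1 _ /=.
rewrite [RHS]mulrA [RHS]mulrBr; congr (_ - _); rewrite !mulr_sumr; apply: eq_bigr => x2 _.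
by rewrite /w3 /=; ring.
Qed.

Lemma I12_theta : ln 2 * I_X1X2_B1B2_given_Q th =
  \sum_q pQ q * cinfo sig12 (fun x => p1 q x.1 * p2 q x.2) (fun _ => 1).
Proof.
rewrite /I_X1X2_B1B2_given_Q ln2_mul H_X1X2Q H_B1B2Q H_X1X2B1B2Q H_Q.
transitivity (\sum_q pQ q * (ln 2 * vN_entropy (mix (fun x => p1 q x.1 * p2 q x.2) (sig12^~ tt)))
   - \sum_c w3 c * (ln 2 * vN_entropy (rho c.1.1 c.1.2))); first by ring.
rewrite [X in _ - X]sum_pair [X in _ - X]exchange_big /= -sumrB; apply: eq_bigr => q _.
rewrite /cinfo sum_unit mul1r [RHS]mulrBr; congr (_ - _); rewrite mulr_sumr; apply: eq_bigr => -[x1 x2] _.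
by rewrite /w3 /=; ring.
Qed.

End SatoInformation.

(** * From decoding errors to Holevo quantities of the empirical letter distributions *)

Section CodeBounds.
Variable R : realType.
Local Notation C := (R[i]).
Local Open Scope complex_scope.

(** The law of [c m] for a uniformly distributed message [m]. *)
Definition emp (M X : finType) (c : M -> X) (x : X) : R :=
  #|M|%:R^-1 * \sum_m (c m == x)%:R.

Lemma emp_sum (M X : finType) (c : M -> X) (g : X -> R) :
  \sum_x emp c x * g x = #|M|%:R^-1 * \sum_m g (c m).
Proof.
rewrite /emp; under eq_bigr do rewrite -mulrA mulr_suml.
rewrite -mulr_sumr exchange_big; congr (_ * _); apply: eq_bigr => m _ /=.
rewrite (bigD1 (c m)) //= eqxx mul1r big1 ?addr0 // => x.
by rewrite eq_sym => /negbTE ->; rewrite mul0r.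
Qed.

Lemma emp_distr (M X : finType) (c : M -> X) : (0 < #|M|)%N -> is_distr (emp c).
Proof.
move=> M0; split=> [x|].
  by rewrite mulr_ge0 ?invr_ge0 ?ler0n // sumr_ge0 // => m _; rewrite ler0n.
transitivity (\sum_x emp c x * 1); first by apply: eq_bigr => x _; rewrite mulr1.
by rewrite emp_sum sumr_const -[1 *+ _]/(#|M|%:R) mulVf // pnatr_eq0 -lt0n.
Qed.

Lemma mix_emp (M X T : finType) (c : M -> X) (f : X -> Op R T) :
  mix (fun _ => #|M|%:R^-1) (fun m => f (c m)) = mix (emp c) f.
Proof.
apply/funext => s; apply/funext => t; rewrite /mix /emp.
under [RHS]eq_bigr do rewrite rmorphM rmorph_sum /= -mulrA mulr_suml.
rewrite -!mulr_sumr [in RHS]exchange_big; congr (_ * _); apply: eq_bigr => m _ /=.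
rewrite (bigD1 (c m)) //= eqxx mul1r big1 ?addr0 // => x.
by rewrite eq_sym => /negbTE ->; rewrite mul0r.
Qed.

Lemma emp_prod (M N X Y : finType) (c : M -> X) (d : N -> Y) x :
  emp (fun m : M * N => (c m.1, d m.2)) x = emp c x.1 * emp d x.2.
Proof.
rewrite /emp card_prod natrM invfM sum_pair mulrACA; congr (_ * _).
rewrite mulr_suml; apply: eq_bigr => m _; rewrite mulr_sumr; apply: eq_bigr => n _ /=.
by case: x => x y; rewrite xpair_eqE -natrM mulnb.
Qed.

(** For a fixed interfering message [i], [product_converse] is applied with [lam = delta * #|M|], so
    that the second error is exactly [delta]. Averaging over [i] turns the interfering letters into
    the conditioning variable of [cinfo]. *)
Lemma holevo_bound (M N X Y T : finType) (n : nat) (c : M -> 'I_n -> X) (d : N -> 'I_n -> Y)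
    (sig : X -> Y -> Op R T) (L : M -> Op R {ffun 'I_n -> T}) (eps delta : R) :
  (forall x y, density (sig x y)) -> povm L -> (0 < #|M|)%N -> (0 < #|N|)%N -> 0 < delta ->
  #|M|%:R^-1 * #|N|%:R^-1 * (\sum_m \sum_i complex.Re
     (op_tr (op_mul (op_sub (@op_id R _) (L m)) (tensn (fun k => sig (c m k) (d i k))))))
    <= eps ->
  2 * (eps + delta) <= 1 ->
  (1 - 2 * (eps + delta)) * ln (delta * #|M|%:R) - 1 <=
  \sum_k cinfo sig (emp (c^~ k)) (emp (d^~ k)).
Proof.
move=> hsig hL M0 N0 d0 he hd.
set w : R := #|M|%:R^-1 in he; set v : R := #|N|%:R^-1 in he.
have w0 : 0 < w by rewrite invr_gt0 ltr0n.
have v0 : 0 < v by rewrite invr_gt0 ltr0n.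
have v1 : \sum_(i : N) v = 1.
  by rewrite sumr_const -mulr_natl divff // pnatr_eq0 -lt0n.
pose e i m := complex.Re
     (op_tr (op_mul (op_sub (@op_id R _) (L m)) (tensn (fun k => sig (c m k) (d i k))))).
pose lam := delta * #|M|%:R.
have lam0 : 0 < lam by rewrite mulr_gt0 // ltr0n.
have lamw : lam * w = delta by rewrite mulfK // pnatr_eq0 -lt0n.
pose f k y := ln 2 * vN_entropy (mix (emp (c^~ k)) (sig^~ y))
                - \sum_x emp (c^~ k) x * (ln 2 * vN_entropy (sig x y)).
have key i : (1 - 2 * (w * \sum_m e i m + delta)) * Num.max 0 (ln lam) - 1 <= \sum_k f k (d i k).
  have := product_converse (fun m k => hsig (c m k) (d i k)) hL M0 lam0 erefl erefl.
  rewrite -/w lamw => /le_trans; apply; apply: ler_sum => k _.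
  by rewrite (mix_emp (c^~ k) (sig^~ (d i k))) /f emp_sum.
have -> : \sum_k cinfo sig (emp (c^~ k)) (emp (d^~ k)) = \sum_i v * \sum_k f k (d i k).
  rewrite -[RHS]mulr_sumr [in RHS]exchange_big [RHS]mulr_sumr; apply: eq_bigr => k _ /=.
  by rewrite -emp_sum.
set mx := Num.max 0 (ln lam) in key *.
(* The coefficient is nonnegative by hypothesis, so [ln lam] may be replaced by its maximum with
   0. *)
apply: le_trans (_ : (1 - 2 * (eps + delta)) * mx - 1 <= _).
  by rewrite lerD2r ler_wpM2l ?subr_ge0 // le_max lexx orbT.
apply: le_trans (_ : \sum_i v * ((1 - 2 * (w * \sum_m e i m + delta)) * mx - 1) <= _); last first.
  by apply: ler_sum => i _; rewrite ler_pM2l.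
have -> : \sum_i v * ((1 - 2 * (w * \sum_m e i m + delta)) * mx - 1) =
    (1 - 2 * (w * v * (\sum_m \sum_i e i m) + delta)) * mx - 1.
  transitivity (\sum_i (v * ((1 - 2 * delta) * mx - 1) - (2 * mx * w * v) * \sum_m e i m)).
    by apply: eq_bigr => i _; ring.
  by rewrite sumrB -mulr_suml v1 -mulr_sumr [in RHS]exchange_big; ring.
rewrite lerD2r ler_wpM2r ?le_max ?lexx // lerD2l lerN2 ler_pM2l // lerD2r.
exact: he.
Qed.

Lemma tr_mul_idB (T : finType) (L A : Op R T) :
  op_tr (op_mul (op_sub (@op_id R T) L) A) = op_tr A - op_tr (op_mul L A).
Proof.
rewrite /op_tr -sumrB; apply: eq_bigr => s _; rewrite /op_mul /op_sub /op_id.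
under eq_bigr do rewrite mulrBl.
rewrite sumrB; congr (_ - _).
rewrite (bigD1 s) //= eqxx mul1r big1 ?addr0 // => t.
by rewrite eq_sym => /negbTE ->; rewrite mul0r.
Qed.

Lemma psd_tr_mul_ge0 (T : finType) (L A : Op R T) :
  psd L -> psd A -> 0 <= complex.Re (op_tr (op_mul L A)).
Proof.
move=> hL hA; have [l [u h]] := hermitian_eigendec hA.1.
rewrite (tr_mul_eigendec L h) Re_sum; apply: sumr_ge0 => j _.
by rewrite Re_realM mulr_ge0 ?(eigendec_ge0 hA h) // psd_expect_ge0.
Qed.

Lemma op_tens_psd (T U : finType) (L : Op R T) (G : Op R U) :
  psd L -> psd G -> psd (op_tens L G).
Proof.
move=> hL hG.
have [l [u hu]] := hermitian_eigendec hL.1; have [g [v hv]] := hermitian_eigendec hG.1.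
apply: (@eigendec_psd R _ (T * U)%type _ (fun z => l z.1 * g z.2)
          (fun z s => u z.1 s.1 * v z.2 s.2)); last first.
  by move=> z; rewrite mulr_ge0 ?(eigendec_ge0 hL hu) ?(eigendec_ge0 hG hv).
split; first split.
- move=> [j k] [j' k']; rewrite /dot sum_pair xpair_eqE -mulnb natrM -hu.1.1 -hv.1.1.
  rewrite /dot mulr_suml; apply: eq_bigr => s _; rewrite mulr_sumr; apply: eq_bigr => t _.
  by rewrite conjcM /=; ring.
- move=> [s t] [s' t']; rewrite sum_pair xpair_eqE -mulnb natrM -hu.1.2 -hv.1.2.
  rewrite mulr_suml; apply: eq_bigr => j _; rewrite mulr_sumr; apply: eq_bigr => k _.
  by rewrite conjcM /=; ring.
- move=> [s t] [s' t']; rewrite sum_pair /op_tens /= hu.2 hv.2.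
  rewrite mulr_suml; apply: eq_bigr => j _; rewrite mulr_sumr; apply: eq_bigr => k _.
  by rewrite conjcM rmorphM /=; ring.
Qed.

(** A pair of receivers succeeds at most as often as the first one alone: summing the joint success
    over all outcomes of [G] gives the success of [L] on the reduced state, and each term is
    nonnegative. *)
Lemma marginal_error1 (T U N : finType) (A : Op R (T * U)%type) (L : Op R T)
    (G : N -> Op R U) i :
  psd A -> psd L -> povm G ->
  complex.Re (op_tr (op_mul (op_sub (@op_id R T) L) (ptr1 A))) <=
  complex.Re (op_tr (op_mul (op_sub (@op_id R _) (op_tens L (G i))) A)).
Proof.
move=> hA hL hG; rewrite !tr_mul_idB !ReB ptr1_tr lerD2l lerN2.
have -> : op_tr (op_mul L (ptr1 A)) = \sum_i op_tr (op_mul (op_tens L (G i)) A).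
  rewrite /op_tr [RHS]exchange_big sum_pair; apply: eq_bigr => s _ /=.
  rewrite /op_mul /ptr1 /=; under eq_bigr do rewrite mulr_sumr.
  rewrite exchange_big; apply: eq_bigr => c _ /=; rewrite [RHS]exchange_big sum_pair /=.
  apply: eq_bigr => t _.
  transitivity (\sum_d (L s t * op_id R c d) * A (t, d) (s, c)).
    rewrite (bigD1 c) //= /op_id eqxx mulr1 big1 ?addr0 // => d.
    by rewrite eq_sym => /negbTE ->; rewrite mulr0 mul0r.
  by apply: eq_bigr => d _; rewrite -hG.2 mulr_sumr mulr_suml.
rewrite [leRHS]Re_sum [leRHS](bigD1 i) //= lerDl; apply: sumr_ge0 => j _.
by apply: psd_tr_mul_ge0 => //; apply: op_tens_psd => //; exact: hG.1.
Qed.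

Lemma relabel_idB (S T : finType) (f : S -> T) (L : Op R T) : injective f ->
  op_sub (@op_id R S) (relabel f L) = relabel f (op_sub (@op_id R T) L).
Proof.
move=> hf; apply/funext => s; apply/funext => t.
by rewrite /op_sub /relabel /op_id (inj_eq hf).
Qed.

Lemma relabel_error (S T : finType) (f : S -> T) (L A : Op R T) : bijective f ->
  op_tr (op_mul (op_sub (@op_id R S) (relabel f L)) (relabel f A)) =
  op_tr (op_mul (op_sub (@op_id R T) L) A).
Proof.
by move=> hf; rewrite relabel_idB ?relabel_mul ?relabel_tr //; exact: bij_inj.
Qed.

Lemma marginal_error2 (T U N : finType) (A : Op R (T * U)%type) (L : N -> Op R T)
    (G : Op R U) i :
  psd A -> povm L -> psd G ->
  complex.Re (op_tr (op_mul (op_sub (@op_id R U) G) (ptr2 A))) <=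
  complex.Re (op_tr (op_mul (op_sub (@op_id R _) (op_tens (L i) G)) A)).
Proof.
move=> hA hL hG; have sb := @swap_bij U T.
have := marginal_error1 i (relabel_psd sb hA) hG hL.
rewrite -(relabel_error (op_tens (L i) G) A sb); congr (_ <= complex.Re (op_tr (op_mul (op_sub _ _) _))).
by apply/funext => s; apply/funext => t; rewrite /op_tens /relabel /= mulrC.
Qed.

Lemma povm_relabel (M S T : finType) (f : S -> T) (L : M -> Op R T) : bijective f ->
  povm L -> povm (fun m => relabel f (L m)).
Proof.
move=> hf [h1 h2]; split=> [m|s t]; first exact: relabel_psd.
by rewrite /relabel h2 /op_id (inj_eq (bij_inj hf)).
Qed.

Lemma povm_tens (M N T U : finType) (L : M -> Op R T) (G : N -> Op R U) :
  povm L -> povm G -> povm (fun m : M * N => op_tens (L m.1) (G m.2)).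
Proof.
move=> hL hG; split=> [m|s t]; first by apply: op_tens_psd; [exact: hL.1|exact: hG.1].
rewrite sum_pair /op_tens /=; under eq_bigr do rewrite -mulr_sumr hG.2.
by rewrite -mulr_suml hL.2 /op_id -natrM mulnb; case: s t => [? ?] [? ?].
Qed.

(** * Converse bounds for one code of the interference channel *)

Section Channel.
Variables (X1 X2 B1 B2 : finType) (rho : X1 -> X2 -> Op R (B1 * B2)%type).
Hypothesis hrho : forall x1 x2, density (rho x1 x2).
Variable n : nat.

(** [rho_n] is indexed by pairs of words, a tensor power by words of pairs; [splitf] and [joinf]
    translate. *)
Definition splitf (s : {ffun 'I_n -> B1 * B2}) : {ffun 'I_n -> B1} * {ffun 'I_n -> B2} :=
  ([ffun i => (s i).1], [ffun i => (s i).2]).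

Definition joinf (s : {ffun 'I_n -> B1} * {ffun 'I_n -> B2}) : {ffun 'I_n -> B1 * B2} :=
  [ffun i => (s.1 i, s.2 i)].

Lemma splitfK : cancel splitf joinf.
Proof. by move=> s; apply/ffunP => i; rewrite !ffunE; case: (s i). Qed.

Lemma joinfK : cancel joinf splitf.
Proof.
by move=> [s t]; congr (_, _); apply/ffunP => i; rewrite !ffunE.
Qed.

Lemma rho_nE (x1 : {ffun 'I_n -> X1}) (x2 : {ffun 'I_n -> X2}) :
  relabel splitf (rho_n rho x1 x2) = tensn (fun k => rho (x1 k) (x2 k)).
Proof.
apply/funext => s; apply/funext => t; apply: eq_bigr => i _; rewrite !ffunE.
by case: (s i) (t i) => [? ?] [? ?].
Qed.

Lemma tensn_psd (T : finType) (A : 'I_n -> Op R T) : (forall k, psd (A k)) -> psd (tensn A).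
Proof.
move=> hA; have [l hl] := fin_all_exists (fun k => hermitian_eigendec (hA k).1).
have [u hu] := fin_all_exists hl.
apply: (eigendec_psd (eigendec_tensn hu)) => f; apply: prodr_ge0 => k _.
exact: eigendec_ge0 (hA k) (hu k) _.
Qed.

Lemma rho_n_psd (x1 : {ffun 'I_n -> X1}) (x2 : {ffun 'I_n -> X2}) : psd (rho_n rho x1 x2).
Proof.
have -> : rho_n rho x1 x2 = relabel joinf (relabel splitf (rho_n rho x1 x2)).
  by apply/funext => s; apply/funext => t; rewrite /relabel !joinfK.
rewrite rho_nE; apply: relabel_psd; first by exists splitf; [exact: joinfK|exact: splitfK].
by apply: tensn_psd => k; exact: (hrho _ _).1.
Qed.

Lemma ptr1_rho_n (x1 : {ffun 'I_n -> X1}) (x2 : {ffun 'I_n -> X2}) :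
  ptr1 (rho_n rho x1 x2) = tensn (fun k => sig1 rho (x1 k) (x2 k)).
Proof.
by apply/funext => s; apply/funext => t; rewrite /tensn /sig1 /ptr1 bigA_distr_bigA.
Qed.

Lemma ptr2_rho_n (x1 : {ffun 'I_n -> X1}) (x2 : {ffun 'I_n -> X2}) :
  ptr2 (rho_n rho x1 x2) = tensn (fun k => sig2 rho (x2 k) (x1 k)).
Proof.
by apply/funext => s; apply/funext => t; rewrite /tensn /sig2 /ptr2 bigA_distr_bigA.
Qed.

Variables (M1 M2 : finType) (c1 : M1 -> {ffun 'I_n -> X1}) (c2 : M2 -> {ffun 'I_n -> X2}).
Variables (L : M1 -> Op R {ffun 'I_n -> B1}) (G : M2 -> Op R {ffun 'I_n -> B2}).
Hypotheses (hL : povm L) (hG : povm G) (hM1 : (0 < #|M1|)%N) (hM2 : (0 < #|M2|)%N).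
Variables (eps delta : R).
Hypotheses (d0 : 0 < delta) (hed : 2 * (eps + delta) <= 1).
Hypothesis herr : #|M1|%:R^-1 * #|M2|%:R^-1 * (\sum_m1 \sum_m2 complex.Re
  (op_tr (op_mul (op_sub (@op_id R _) (op_tens (L m1) (G m2))) (rho_n rho (c1 m1) (c2 m2))))) <= eps.
Let p1 k := emp (fun m => c1 m k).
Let p2 k := emp (fun m => c2 m k).

Let w0 : 0 <= #|M1|%:R^-1 * #|M2|%:R^-1 :> R.
Proof. by rewrite mulr_ge0 // invr_ge0 ler0n. Qed.

Lemma code_bound1 :
  (1 - 2 * (eps + delta)) * ln (delta * #|M1|%:R) - 1 <= \sum_k cinfo (sig1 rho) (p1 k) (p2 k).
Proof.
apply: (@holevo_bound _ _ _ _ _ _ (fun m k => c1 m k) (fun m k => c2 m k) _ L) => //.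
  by move=> x y; apply: ptr1_density.
apply: le_trans herr; apply: ler_wpM2l => //.
apply: ler_sum => m1 _; apply: ler_sum => m2 _; rewrite -ptr1_rho_n.
by apply: marginal_error1 => //; [exact: rho_n_psd | exact: hL.1].
Qed.

Lemma code_bound2 :
  (1 - 2 * (eps + delta)) * ln (delta * #|M2|%:R) - 1 <= \sum_k cinfo (sig2 rho) (p2 k) (p1 k).
Proof.
apply: (@holevo_bound _ _ _ _ _ _ (fun m k => c2 m k) (fun m k => c1 m k) _ G) => //.
  by move=> x y; apply: ptr2_density.
apply: le_trans herr; rewrite [X in X * _]mulrC; apply: ler_wpM2l => //.
rewrite exchange_big; apply: ler_sum => m1 _; apply: ler_sum => m2 _; rewrite -ptr2_rho_n.
by apply: marginal_error2 => //; [exact: rho_n_psd | exact: hG.1].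
Qed.

(** Both receivers together act as one receiver decoding the message pair with the product
    measurement; there is no interferer. Independent messages make the letter law a product. *)
Lemma code_bound12 :
  (1 - 2 * (eps + delta)) * ln (delta * (#|M1|%:R * #|M2|%:R)) - 1 <=
  \sum_k cinfo (sig12 rho) (fun x => p1 k x.1 * p2 k x.2) (fun _ => 1).
Proof.
have bs : bijective splitf by exists joinf; [exact: splitfK|exact: joinfK].
have := @holevo_bound _ unit _ unit _ _ (fun (m : M1 * M2) k => (c1 m.1 k, c2 m.2 k))
  (fun _ _ => tt) (sig12 rho) (fun m => relabel splitf (op_tens (L m.1) (G m.2))) eps delta
  (fun x _ => hrho _ _) (povm_relabel bs (povm_tens hL hG)).
rewrite card_prod muln_gt0 hM1 hM2 card_unit invr1 mulr1 natrM invfM => /(_ isT isT d0) h.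
apply: le_trans (h _ hed) _.
  apply: le_trans herr; apply: ler_wpM2l => //.
  rewrite sum_pair; apply: ler_sum => m1 _; apply: ler_sum => m2 _; rewrite sum_unit /=.
  by rewrite /sig12 /= -rho_nE relabel_error.
apply: ler_sum => k _; rewrite /cinfo !sum_unit {1}/emp card_unit sum_unit eqxx invr1 !mul1r.
rewrite (_ : emp _ = fun x => p1 k x.1 * p2 k x.2) //.
by apply/funext => x; rewrite -emp_prod.
Qed.

End Channel.
End CodeBounds.

(** * Caratheodory's theorem for conic combinations *)

Section Caratheodory.
Variable R : realType.

(** More vectors than dimensions are dependent; changing the sign of the relation makes some
    coefficient positive. *)
Lemma dependent_positive (n d : nat) (v : 'I_n -> 'rV[R]_d) : (d < n)%N ->
  exists (c : 'I_n -> R) (i : 'I_n), \sum_j c j *: v j = 0 /\ 0 < c i.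
Proof.
move=> dn; pose A := \matrix_i v i.
have : kermx A != 0.
  rewrite -mxrank_eq0 mxrank_ker subn_eq0 -ltnNge.
  exact: leq_ltn_trans (rank_leq_col _) dn.
move=> /rowV0Pn[c /sub_kermxP cA c0].
have [i ci] : exists i, c 0 i != 0 by apply/rV0Pn.
have E : \sum_j c 0 j *: v j = 0.
  by rewrite -[RHS]cA mulmx_sum_row; apply: eq_bigr => j _; rewrite rowK.
have [cp|cn|c_eq0] := ltgtP 0 (c 0 i).
- by exists (fun j => c 0 j), i.
- exists (fun j => - c 0 j), i; split; last by rewrite oppr_gt0.
  by under eq_bigr do rewrite scaleNr; rewrite sumrN E oppr0.
- by rewrite -c_eq0 eqxx in ci.
Qed.

Lemma conic_reduce (n d : nat) (v : 'I_n -> 'rV[R]_d) (w : 'I_n -> R) : (d < n)%N ->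
  (forall i, 0 <= w i) ->
  exists (w' : 'I_n -> R) (j : 'I_n),
    [/\ forall i, 0 <= w' i, w' j = 0 & \sum_i w' i *: v i = \sum_i w i *: v i].
Proof.
move=> dn w0; have [c [i0 [E ci0]]] := dependent_positive v dn.
(* Moving the weights along the relation, [j] is the first index whose weight reaches zero; the
   others are still nonnegative. *)
pose j := [arg min_(i < i0 | 0 < c i) (w i / c i)]%O.
have [cj jmin] : 0 < c j /\ forall i, 0 < c i -> w j / c j <= w i / c i.
  by rewrite /j; case: arg_minP.
exists (fun i => w i - w j / c j * c i), j; split.
- move=> i; rewrite subr_ge0; have [ci|ci] := leP (c i) 0.
    by apply: le_trans (w0 i); rewrite mulr_ge0_le0 // divr_ge0 // ltW.
  by rewrite -ler_pdivlMr // jmin.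
- by rewrite divfK ?subrr // gt_eqF.
- under eq_bigr do rewrite scalerBl -scalerA.
  by rewrite sumrB -scaler_sumr E scaler0 subr0.
Qed.

(* For convex combinations, [f] has a coordinate that is constantly 1. *)
Lemma conic_caratheodory (P : Type) (d : nat) (f : P -> 'rV[R]_d) (n : nat)
    (p : 'I_n -> P) (w : 'I_n -> R) : (d <= n)%N -> (forall i, 0 <= w i) ->
  exists (p' : 'I_d -> P) (w' : 'I_d -> R),
    (forall i, 0 <= w' i) /\ \sum_i w' i *: f (p' i) = \sum_i w i *: f (p i).
Proof.
elim: n p w => [|n IH] p w; rewrite leq_eqVlt => /orP[/eqP E|dn] w0.
- by subst d; exists p, w.
- by [].
- by subst d; exists p, w.
have [w' [j [w'0 w'j E]]] := conic_reduce (f \o p) dn w0.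
have [p2 [w2 [w20 E2]]] := IH (p \o lift j) (w' \o lift j) dn (fun i => w'0 _).
exists p2, w2; split => //; rewrite E2 -E (bigD1_ord j) //= w'j scale0r add0r.
by [].
Qed.

End Caratheodory.

(** * Convergent subsequences and upper semicontinuity of the informations *)

Section UpperLimit.
Import numFieldNormedType.Exports.
Variable R : realType.
Local Open Scope classical_set_scope.

(** Compactness of the cube, with the family stored as a row vector. Instead of a strictly
    increasing [phi], only [N <= phi N] is recorded, which suffices to carry over bounds with
    vanishing error. *)
Lemma bolzano_weierstrass_family (I : finType) (x : nat -> I -> R) :
  (forall k i, 0 <= x k i <= 1) ->
  exists (phi : nat -> nat) (y : I -> R),
    (forall N, (N <= phi N)%N) /\ forall i, x (phi N) i @[N --> \oo] --> y i.
Proof.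
move=> hx; pose X k : 'rV[R]_#|I| := \row_i x k (enum_val i).
have Kc : compact [set v : 'rV[R]_#|I| | forall i, `[0, 1]%classic (v ord0 i)].
  apply: (@rV_compact _ _ (fun=> `[(0 : R), 1]%classic)) => i; exact: segment_compact.
have [|y [_ cl]] := Kc (X @ \oo) _.
  by exists 0%N => // k _ i /=; rewrite mxE in_itv /= hx.
have ex N : exists k, (N <= k)%N /\ ball y (N.+1%:R^-1) (X k).
  have [||z [[k Nk <-] hb]] := cl (X @` [set k | (N <= k)%N]) (ball y (N.+1%:R^-1)).
  - by exists N => // k Nk; exists k.
  - by apply: nbhsx_ballx; rewrite invr_gt0 ltr0n.
  - by exists k.
have [phi hphi] := choice ex.
exists phi, (fun i => y ord0 (enum_rank i)); split => [N|i]; first by case: (hphi N).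
apply/cvgrPdist_lt => e e0.
near=> N.
have [_ [_ /(_ ord0 (enum_rank i))]] := hphi N.
rewrite mxE enum_rankK => /lt_trans; apply.
near: N; exact: (near_infty_natSinv_lt (PosNum e0)).
Unshelve. all: by end_near. Qed.

(* [limsup F <= l], in the form in which it is stable under sums and under
   products with convergent nonnegative sequences. *)
Definition upper_lim (F : nat -> R) (l : R) : Prop :=
  forall e : R, 0 < e -> exists (G : nat -> R) (g : R),
    [/\ forall N, F N <= G N, G @ \oo --> g & g <= l + e].

Lemma upper_lim_cvg (F : nat -> R) (l : R) : F @ \oo --> l -> upper_lim F l.
Proof. by move=> h e e0; exists F, l; split => //; rewrite lerDl ltW. Qed.

Lemma upper_limD (F G : nat -> R) (l m : R) :
  upper_lim F l -> upper_lim G m -> upper_lim (fun N => F N + G N) (l + m).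
Proof.
move=> hF hG e e0; have e2 : 0 < e / 2 by rewrite divr_gt0.
have [F' [f [hF1 hF2 hF3]]] := hF _ e2; have [G' [g [hG1 hG2 hG3]]] := hG _ e2.
exists (fun N => F' N + G' N), (f + g); split; last by lra.
- by move=> N; exact: lerD.
- exact: cvgD.
Qed.

Lemma upper_lim_sum (I : finType) (F : I -> nat -> R) (l : I -> R) :
  (forall i, upper_lim (F i) (l i)) -> upper_lim (fun N => \sum_i F i N) (\sum_i l i).
Proof.
move=> h.
suff : upper_lim (\sum_i F i) (\sum_i l i).
  by rewrite (_ : \sum_i F i = fun N => \sum_i F i N) //; apply/funext => N; rewrite fct_sumE.
elim/big_rec2: _ => [|i x y _ hy]; first by apply: upper_lim_cvg; exact: cvg_cst.
exact: upper_limD.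
Qed.

Lemma upper_limM (a F : nat -> R) (b l : R) : (forall N, 0 <= a N) -> 0 <= b ->
  a @ \oo --> b -> upper_lim F l -> upper_lim (fun N => a N * F N) (b * l).
Proof.
move=> a0 b0 ab hF e e0; have b1 : 0 < b + 1 by rewrite ltr_wpDl.
have [G [g [h1 h2 h3]]] := hF _ (divr_gt0 e0 b1).
exists (fun N => a N * G N), (b * g); split.
- by move=> N; exact: ler_wpM2l.
- exact: cvgM.
- apply: le_trans (ler_wpM2l b0 h3) _; rewrite mulrDr lerD2l mulrCA.
  by rewrite ger_pMr // ler_pdivrMr // mul1r lerDl.
Qed.

Lemma cvg_sumr (I : finType) (F : I -> nat -> R) (l : I -> R) :
  (forall i, F i @ \oo --> l i) -> \sum_i F i N @[N --> \oo] --> \sum_i l i.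
Proof.
move=> h; rewrite (_ : (fun N => \sum_i F i N) = \sum_i F i); last first.
  by apply/funext => N; rewrite fct_sumE.
elim/big_rec2: _ => [|i x y _ hy]; first exact: cvg_cst.
exact: cvgD.
Qed.

Lemma le_upper_lim (c a : R) (F : nat -> R) (l : R) : upper_lim F l ->
  (forall N, c - a * N.+1%:R^-1 <= F N) -> c <= l.
Proof.
move=> hF hc; apply/ler_addgt0Pr => e e0.
have [G [g [h1 h2 h3]]] := hF _ e0; apply: le_trans h3.
have h4 : c - a * N.+1%:R^-1 @[N --> \oo] --> c - a * 0.
  by apply: cvgB; [exact: cvg_cst | apply: cvgM; [exact: cvg_cst | exact: cvg_harmonic]].
rewrite mulr0 subr0 in h4.
by apply: ler_cvg_to h4 h2 _; near=> N; apply: le_trans (h1 N).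
Unshelve. all: by end_near. Qed.

Lemma cvg_distr (X : finType) (p : nat -> X -> R) (q : X -> R) :
  (forall N, is_distr (p N)) -> (forall x, p N x @[N --> \oo] --> q x) -> is_distr q.
Proof.
move=> hp hq; split=> [x|].
  by apply: ler_cvg_to (cvg_cst 0) (hq x) _; near=> N; exact: (hp N).1.
have := cvg_sumr hq; under eq_fun do rewrite (hp _).2.
move=> h; have h1 : (fun _ : nat => 1 : R) @ \oo --> (1 : R) by exact: cvg_cst.
exact: (cvg_unique _ h h1).
Unshelve. all: by end_near. Qed.

(** Only the entropy of the mixture is not polynomial in the distributions, and there
    [entropy_mix_majorant] at the limit point supplies a convergent majorant. *)
Lemma upper_lim_cinfo (X Y T : finType) (sig : X -> Y -> Op R T)
    (p : nat -> X -> R) (q : nat -> Y -> R) (p' : X -> R) (q' : Y -> R) :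
  (forall x y, density (sig x y)) ->
  (forall N, is_distr (p N)) -> (forall N, is_distr (q N)) ->
  (forall x, p N x @[N --> \oo] --> p' x) -> (forall y, q N y @[N --> \oo] --> q' y) ->
  upper_lim (fun N => cinfo sig (p N) (q N)) (cinfo sig p' q').
Proof.
move=> hsig hp hq cp cq; have hp' := cvg_distr hp cp; have hq' := cvg_distr hq cq.
apply: upper_lim_sum => y; apply: upper_limM => //; first by move=> N; exact: (hq N).1.
  exact: hq'.1.
apply: upper_limD; last first.
  apply: upper_lim_cvg; apply: cvgN; apply: cvg_sumr => x.
  by apply: cvgM => //; exact: cvg_cst.
move=> e e0; have [c [hc1 hc2]] := entropy_mix_majorant (hsig^~ y) hp' e0.
exists (fun N => \sum_x p N x * c x), (\sum_x p' x * c x); split => //.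
- by move=> N; exact: hc1.
- by apply: cvg_sumr => x; apply: cvgM => //; exact: cvg_cst.
Qed.

End UpperLimit.

(** * Single-letter bounds with time sharing, and their passage to the limit *)

Section Sato.
Import numFieldNormedType.Exports.
Variables (R : realType) (X1 X2 B1 B2 : finType).
Variable rho : X1 -> X2 -> Op R (B1 * B2)%type.
Hypothesis hrho : forall x1 x2, density (rho x1 x2).

(** The bounds are in nats. The sum bound [r12] is independent of [r1] and [r2], since the three
    bounds lose different amounts on the way. *)
Definition sato_bounds (Q : finType) (w : Q -> R) (p1 : Q -> X1 -> R) (p2 : Q -> X2 -> R)
    (r1 r2 r12 : R) : Prop :=
  [/\ is_distr w, forall q, is_distr (p1 q), forall q, is_distr (p2 q) &
  [/\ r1 <= \sum_q w q * cinfo (sig1 rho) (p1 q) (p2 q),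
      r2 <= \sum_q w q * cinfo (sig2 rho) (p2 q) (p1 q) &
      r12 <= \sum_q w q * cinfo (sig12 rho) (fun x => p1 q x.1 * p2 q x.2) (fun _ => 1)]].

Lemma rate_bound (n : nat) (M S delta t x K : R) : (0 < n)%N -> 0 < delta -> 0 < M ->
  0 <= t <= 1 -> 1 - ln delta <= K -> 1 <= K ->
  2 `^ (n%:R * x) <= M ->
  t * ln (delta * M) - 1 <= S -> ln 2 * (t * x) - K / n%:R <= n%:R^-1 * S.
Proof.
move=> n0 d0 M0 /andP[t0 t1] hK K1 hM hS.
have n0' : 0 < n%:R :> R by rewrite ltr0n.
have hln : n%:R * x * ln 2 <= ln M.
  by rewrite -ln_powR ler_ln ?posrE // powR_gt0.
rewrite lnM ?posrE // in hS.
rewrite [leRHS]mulrC ler_pdivlMr // mulrBl divfK ?gt_eqF //.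
have h1 := ler_wpM2l t0 hln.
(* The left side is affine in [t], so it is enough to check [t = 0] and [t = 1]: these are the two
   hypotheses on [K]. *)
have h2 : 1 - t * ln delta <= K by nra.
by lra.
Qed.

(** Each rate loses [e] by the slack in achievability, [e] by the constant [K / n] and [e] by the
    factor [t = 1 - 4 * delta]. For the sum only the slack counts twice, which gives [4 * e]. *)
Lemma achievable_bounds (a b e : R) : 0 < e -> achievable rho a b ->
  exists n : nat, (4 <= n)%N /\ exists (p1 : 'I_n -> X1 -> R) (p2 : 'I_n -> X2 -> R),
    sato_bounds (fun _ => n%:R^-1) p1 p2
      (ln 2 * (a - 3 * e)) (ln 2 * (b - 3 * e)) (ln 2 * (a + b - 4 * e)).
Proof.
move=> e0 [a0 [b0 hach]].
have l2 := ln2_gt0 R.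
pose c : R := a + b + 1; have c1 : 1 <= c by rewrite lerDr addr_ge0.
have c0 : 0 < c by exact: lt_le_trans c1.
(* Chosen so that [4 * delta * c <= e] and [8 * delta <= 1]. It serves both as the error of the code
   and as the second error of the test. *)
pose delta := e / (8 * c * (1 + e)).
have e1 : 0 < 1 + e by rewrite addr_gt0.
have d0 : 0 < delta by rewrite divr_gt0 // !mulr_gt0.
have hd : delta * c * 8 * (1 + e) = e by rewrite /delta; field; rewrite !gt_eqF.
have hdc : 4 * delta * c <= e.
  have dc0 : 0 <= delta * c by rewrite mulr_ge0 ?ltW.
  have : 0 <= delta * c * e by rewrite mulr_ge0 // ltW.
  by lra.
have hd8 : 8 * delta <= 1.
  have dc1 : delta <= delta * c by rewrite ler_peMr // ltW.
  have : delta * e <= delta * c * e by rewrite ler_pM2r.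
  by move=> de; rewrite -(ler_pM2r e1); lra.
pose K := 1 + `|ln delta|.
have hK : 1 - ln delta <= K by rewrite lerD2l ler_normr lexx orbT.
have K1 : 1 <= K by rewrite lerDl.
have [N hN] := hach delta e d0 e0.
(* Beyond the threshold [N], at least 4 for Caratheodory, and large enough for
   [K / n <= e * ln 2]. *)
pose n := (N + 4 + Num.bound (K / (e * ln 2)))%N.
have n4 : (4 <= n)%N by rewrite /n -addnA (leq_trans (leq_addl N 4)) // leq_add2l leq_addr.
have n0 : (0 < n)%N by exact: leq_trans n4.
have hKn : K / n%:R <= e * ln 2.
  rewrite ler_pdivrMr ?ltr0n // mulrC -ler_pdivrMr ?mulr_gt0 //.
  have /archi_boundP/ltW/le_trans : 0 <= K / (e * ln 2) by rewrite divr_ge0 ?mulr_ge0 ?ltW // (lt_le_trans ltr01).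
  by apply; rewrite ler_nat leq_addl.
have [M1 [M2 [c1' [c2' [L [G [[m1 _] [m2 _] hL hG herr]]]]]]] : code_exists rho n (a - e) (b - e) delta.
  by apply: hN; rewrite /n -addnA leq_addr.
have M1p : 0 < M1%:R :> R by apply: lt_le_trans m1; rewrite powR_gt0.
have M2p : 0 < M2%:R :> R by apply: lt_le_trans m2; rewrite powR_gt0.
have hM1 : (0 < #|'I_M1|)%N by rewrite card_ord -(ltr0n R).
have hM2 : (0 < #|'I_M2|)%N by rewrite card_ord -(ltr0n R).
have hed : 2 * (delta + delta) <= 1 by lra.
have {}herr : #|'I_M1|%:R^-1 * #|'I_M2|%:R^-1 * (\sum_i1 \sum_i2 complex.Re
    (op_tr (op_mul (op_sub (@op_id R _) (op_tens (L i1) (G i2))) (rho_n rho (c1' i1) (c2' i2)))))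
    <= delta.
  move: herr => /Re_le; rewrite !card_ord -invfM -natrM.
  rewrite (_ : ((M1 * M2)%:R^-1 : R[i]) = real_complex R (M1 * M2)%:R^-1); last first.
    by rewrite fmorphV rmorph_nat.
  rewrite Re_realM Re_sum.
  by under eq_bigr do rewrite Re_sum.
have t01 : 0 <= 1 - 2 * (delta + delta) <= 1 by lra.
have h1 := code_bound1 hrho hL hG hM1 hM2 d0 hed herr.
have h2 := code_bound2 hrho hL hG hM1 hM2 d0 hed herr.
have h12 := code_bound12 hrho hL hG hM1 hM2 d0 hed herr.
rewrite !card_ord in h1 h2 h12.
have m12 : 2 `^ (n%:R * (a - e + (b - e))) <= M1%:R * M2%:R.
  rewrite mulrDr powRD; last by rewrite pnatr_eq0 implybT.
  by apply: ler_pM => //; exact: powR_ge0.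
have r1 := rate_bound n0 d0 M1p t01 hK K1 m1 h1.
have r2 := rate_bound n0 d0 M2p t01 hK K1 m2 h2.
have r12 := rate_bound n0 d0 (mulr_gt0 M1p M2p) t01 hK K1 m12 h12.
exists n; split => //; exists (fun k => emp R (c1'^~ k)), (fun k => emp R (c2'^~ k)).
split; try by move=> k; exact: emp_distr.
  split=> [_|]; first by rewrite invr_ge0 ler0n.
  by rewrite sumr_const card_ord -[LHS]mulr_natl divff // pnatr_eq0 -lt0n.
have da0 : 0 <= delta * a by rewrite mulr_ge0 // ltW.
have db0 : 0 <= delta * b by rewrite mulr_ge0 // ltW.
rewrite /c in hdc.
have de : 0 <= delta * e by rewrite mulr_ge0 // ltW.
rewrite -!mulr_sumr; split.
- apply: le_trans r1; rewrite lerBrDr; apply: (le_trans (lerD (lexx _) hKn)).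
  by rewrite [e * _]mulrC -mulrDr ler_pM2l //; lra.
- apply: le_trans r2; rewrite lerBrDr; apply: (le_trans (lerD (lexx _) hKn)).
  by rewrite [e * _]mulrC -mulrDr ler_pM2l //; lra.
- apply: le_trans r12; rewrite lerBrDr; apply: (le_trans (lerD (lexx _) hKn)).
  by rewrite [e * _]mulrC -mulrDr ler_pM2l //; lra.
Qed.

(** The four coordinates are the constant 1, which keeps the weights normalized, and the three
    informations, whose averages are preserved. Points range over [P], so the selected inputs are
    still distributions. *)
Lemma sato_bounds_caratheodory (n : nat) (w : 'I_n -> R) p1 p2 r1 r2 r12 : (4 <= n)%N ->
  sato_bounds w p1 p2 r1 r2 r12 ->
  exists (w' : 'I_4 -> R) p1' p2', sato_bounds w' p1' p2' r1 r2 r12.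
Proof.
move=> n4 [hw h1 h2 [b1 b2 b12]].
pose P := {z : (X1 -> R) * (X2 -> R) | is_distr z.1 /\ is_distr z.2}.
pose g (z : P) (i : 'I_4) : R :=
  nth 0 [:: 1; cinfo (sig1 rho) (sval z).1 (sval z).2; cinfo (sig2 rho) (sval z).2 (sval z).1;
    cinfo (sig12 rho) (fun x => (sval z).1 x.1 * (sval z).2 x.2) (fun _ => 1)] i.
pose f (z : P) : 'rV[R]_4 := \row_i g z i.
pose p k : P := exist _ (p1 k, p2 k) (conj (h1 k) (h2 k)).
have [p' [w' [w'0 E]]] := conic_caratheodory f p n4 hw.1.
have Ei i : \sum_q w' q * g (p' q) i = \sum_q w q * g (p q) i.
  move/rowP: E => /(_ i); rewrite !summxE.
  by under eq_bigr do rewrite !mxE; under [in RHS]eq_bigr do rewrite !mxE.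
exists w', (fun q => (sval (p' q)).1), (fun q => (sval (p' q)).2); split.
- split => //; have := Ei (inord 0); rewrite /g inordK //=.
  under eq_bigr do rewrite mulr1; under [in RHS]eq_bigr do rewrite mulr1.
  by rewrite hw.2.
- by move=> q; case: (svalP (p' q)).
- by move=> q; case: (svalP (p' q)).
- split.
  + by have := Ei (inord 1); rewrite /g inordK //= => ->.
  + by have := Ei (inord 2); rewrite /g inordK //= => ->.
  + by have := Ei (inord 3); rewrite /g inordK //= => ->.
Qed.

Lemma is_distr_le1 (T : finType) (p : T -> R) t : is_distr p -> 0 <= p t <= 1.
Proof.
by move=> [p0 <-]; rewrite p0 (bigD1 t) //= lerDl sumr_ge0.
Qed.

(** With four time-sharing values all parameters lie in one finite-dimensional cube, so solutions
    with slack [1 / (N + 1)] have a convergent subsequence, and the bounds survive by upper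
    semicontinuity. *)
Lemma sato_bounds_closed (r1 r2 r12 : R) :
  (forall e : R, 0 < e -> exists (w : 'I_4 -> R) p1 p2,
     sato_bounds w p1 p2 (r1 - e) (r2 - e) (r12 - e)) ->
  exists (w : 'I_4 -> R) p1 p2, sato_bounds w p1 p2 r1 r2 r12.
Proof.
move=> h.
have [w hw] := choice (fun N : nat => h N.+1%:R^-1 (ltac:(by rewrite invr_gt0 ltr0n))).
have [p1 {}hw] := choice hw; have [p2 {}hw] := choice hw.
pose I := ('I_4 + ('I_4 * X1) + ('I_4 * X2))%type.
pose x N (i : I) : R := match i with
  | inl (inl q) => w N q | inl (inr z) => p1 N z.1 z.2 | inr z => p2 N z.1 z.2 end.
have hx N i : 0 <= x N i <= 1.
  have [h0 h1 h2 _] := hw N.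
  case: i => [[q|z]|z].
  - exact: is_distr_le1 h0.
  - exact: is_distr_le1 (h1 z.1).
  - exact: is_distr_le1 (h2 z.1).
have [phi [y [hphi hy]]] :=
  @bolzano_weierstrass_family R (('I_4 + ('I_4 * X1) + ('I_4 * X2))%type : finType) x hx.
pose w' q := y (inl (inl q)); pose p1' q x1 := y (inl (inr (q, x1))).
pose p2' q x2 := y (inr (q, x2)).
have cw q := hy (inl (inl q)).
have cp1 q x1 := hy (inl (inr (q, x1))).
have cp2 q x2 := hy (inr (q, x2)).
have dw N : is_distr (w (phi N)) by case: (hw (phi N)).
have dp1 N q : is_distr (p1 (phi N) q) by case: (hw (phi N)).
have dp2 N q : is_distr (p2 (phi N) q) by case: (hw (phi N)).
have dw' : is_distr w' := cvg_distr dw cw.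
have dp1' q : is_distr (p1' q) := cvg_distr (dp1^~ q) (cp1 q).
have dp2' q : is_distr (p2' q) := cvg_distr (dp2^~ q) (cp2 q).
(* The slack along the subsequence is no larger than the slack [1 / (N + 1)] required by
   [le_upper_lim]. *)
have hN N : (phi N).+1%:R^-1 <= N.+1%:R^-1 :> R.
  by rewrite lef_pV2 ?posrE ?ltr0n // ler_nat ltnS.
exists w', p1', p2'; split => //; split.
- apply: (@le_upper_lim _ _ 1 (fun N => \sum_q w (phi N) q *
    cinfo (sig1 rho) (p1 (phi N) q) (p2 (phi N) q))) => [|N]; last first.
    have [_ _ _ [b _ _]] := hw (phi N); apply: le_trans b.
    by rewrite mul1r lerD2l lerN2.
  apply: upper_lim_sum => q; apply: upper_limM; [by move=> N; exact: (dw N).1|exact: dw'.1|exact: cw|].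
  by apply: upper_lim_cinfo; [move=> x1 x2; exact: ptr1_density| | |exact: cp1|exact: cp2].
- apply: (@le_upper_lim _ _ 1 (fun N => \sum_q w (phi N) q *
    cinfo (sig2 rho) (p2 (phi N) q) (p1 (phi N) q))) => [|N]; last first.
    have [_ _ _ [_ b _]] := hw (phi N); apply: le_trans b.
    by rewrite mul1r lerD2l lerN2.
  apply: upper_lim_sum => q; apply: upper_limM; [by move=> N; exact: (dw N).1|exact: dw'.1|exact: cw|].
  by apply: upper_lim_cinfo; [move=> x2 x1; exact: ptr2_density| | |exact: cp2|exact: cp1].
- apply: (@le_upper_lim _ _ 1 (fun N => \sum_q w (phi N) q *
    cinfo (sig12 rho) (fun x => p1 (phi N) q x.1 * p2 (phi N) q x.2) (fun _ => 1))) => [|N]; last first.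
    have [_ _ _ [_ _ b]] := hw (phi N); apply: le_trans b.
    by rewrite mul1r lerD2l lerN2.
  apply: upper_lim_sum => q; apply: upper_limM; [by move=> N; exact: (dw N).1|exact: dw'.1|exact: cw|].
  apply: upper_lim_cinfo.
  + by move=> z []; exact: hrho.
  + by move=> N; exact: (prod_distr (dp1 N) (dp2 N)).
  + by move=> _; split=> [_|]; [exact: ler01 | rewrite sum_unit].
  + by move=> z; apply: cvgM; [exact: cp1 | exact: cp2].
  + by move=> _; exact: cvg_cst.
Qed.

End Sato.

(** * From the capacity region to the Sato region *)

Unset Implicit Arguments.

Theorem theorem5p6 (R : realType) (X1 X2 B1 B2 : finType)
  (rho : X1 -> X2 -> Op R (B1 * B2)%type)
  (hrho : forall x1 x2, density (rho x1 x2)) :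
  forall R1 R2 : R, in_capacity_region rho R1 R2 -> in_R_Sato rho R1 R2.
Proof.
move=> R1 R2 hcap; have l2 := ln2_gt0 R.
have [R10 R20] : 0 <= R1 /\ 0 <= R2.
  split; apply/ler_addgt0Pr => e e0; have [a [b [[a0 [b0 _]] [ha hb]]]] := hcap e e0.
    by move: ha; rewrite ltr_norml => /andP[_]; lra.
  by move: hb; rewrite ltr_norml => /andP[_]; lra.
have [|w [p1 [p2 [hw h1 h2 [b1 b2 b12]]]]] :=
    @sato_bounds_closed _ _ _ _ _ _ hrho (ln 2 * R1) (ln 2 * R2) (ln 2 * (R1 + R2)).
  (* The sum rate loses [2 * d] in the approximation by an achievable pair and [4 * d] in
     [achievable_bounds]; each single rate loses only [d + 3 * d]. *)
  move=> e e0; pose d := e / (6 * ln 2); have d0 : 0 < d by rewrite divr_gt0 // mulr_gt0.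
  have ed : e = ln 2 * (6 * d) by rewrite /d; field; rewrite gt_eqF.
  have [a [b [hab [ha hb]]]] := hcap d d0.
  have [n [n4 [p1 [p2 hs]]]] := achievable_bounds hrho d0 hab.
  have [w [p1' [p2' [hw h1 h2 [b1 b2 b12]]]]] := sato_bounds_caratheodory n4 hs.
  move: ha hb; rewrite !ltr_norml => /andP[ha _] /andP[hb _].
  exists w, p1', p2'; split => //; split.
  - by apply: le_trans b1; rewrite ed -mulrBr ler_pM2l //; lra.
  - by apply: le_trans b2; rewrite ed -mulrBr ler_pM2l //; lra.
  - by apply: le_trans b12; rewrite ed -mulrBr ler_pM2l //; lra.
(* The factor [ln 2] converts the bounds from nats back to bits. *)
exists 'I_4, w, p1, p2; split => //; split; rewrite -(ler_pM2l l2).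
- by rewrite (I1_theta hrho).
- by rewrite (I2_theta hrho).
- by rewrite (I12_theta hrho).
Qed.
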